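(* Let $(\alpha_n)_n$ be a sequence in $L_\infty(0,1)$ such that $(\alpha_n^{-1})_n$ converges in $\sigma(L_\infty,L_1)$ to some $\beta\in L_\infty(0,1)$ with $\mathfrak{m}(\beta)\neq0$. If $\alpha_\infty:=\beta^{-1}\in L_\infty(0,1)$, then, for the associated multiplication operators on $L_2(0,1)$, $\alpha_n(\mathrm{m})$ $G$-converges to $\alpha_\infty(\mathrm{m})$ as $n\to\infty$.
   Context: $\mathfrak{m}(\beta):=\int_0^1\beta$ is the integral mean; $\sigma(L_\infty,L_1)$ is the weak-$*$ topology of $L_\infty(0,1)$. For $\gamma\in L_\infty(0,1)$, $\gamma(\mathrm{m})$ is the operator of multiplication by $\gamma$ on $L_2(0,1)$. Let $\Omega=(0,1)$, let $g_0(\Omega):=\{u';\ u\in H_0^1(\Omega)\}$, a closed subspace of $L_2(\Omega)$, let $\iota_0\colon g_0(\Omega)\hookrightarrow L_2(\Omega)$ be the canonical embedding, and let $M(\Omega)$ be the set of $\tilde a\in L_\infty(\Omega)$ (identified with their multiplication operators) such that $\iota_0^*\tilde a\iota_0$ is continuously invertible on $g_0(\Omega)$; equivalently, for every $f\in H^{-1}(\Omega)$ the problem $-(\tilde a u')'=f$ has a unique solution $u\in H_0^1(\Omega)$. For a sequence $(\tilde a_n)_n$ in $M(\Omega)$ and $\tilde a\in M(\Omega)$, $(\tilde a_n)_n$ is said to $G$-converge to $\tilde a$ if for all $f\in H^{-1}(\Omega)$ and $u_n\in H_0^1(\Omega)$ with $-(\tilde a_nu_n')'=f$ one has $u_n\to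 u$ weakly in $H_0^1(\Omega)$, where $u\in H_0^1(\Omega)$ satisfies $-(\tilde au')'=f$.
   Formalization: G-convergence is defined only for sequences in M(Ω), but finitely many α_n may fail to lie in M(Ω) (when α_n^{-1} has integral mean 0); the formal version states that α_n lies in M(Ω) for all n from some N on and that this tail G-converges to α_∞. *)

(* Defs.v *)
From HB Require Import structures.
From mathcomp Require Import all_boot all_order all_algebra.
From mathcomp Require Import all_classical all_reals all_analysis.
From mathcomp Require Import complex.

Set Implicit Arguments.
Unset Strict Implicit.
Unset Printing Implicit Defensive.

Import Order.TTheory GRing.Theory Num.Theory.
Import numFieldNormedType.Exports.

Local Open Scope classical_set_scope.
Local Open Scope complex_scope.
Local Open Scope ring_scope.

(* Elements of L_p(0,1) are represented by functions R -> R[i]: only their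
   values on ]0,1[ matter, and equality in L_p is a.e. equality on ]0,1[. *)
Section defs.
Context (R : realType).
Implicit Types (f g h u v q r : R -> R[i]).

Let mu := @lebesgue_measure R.

Definition I01 : set R := `]0%R, 1%R[.

Definition almost_all01 (P : R -> Prop) : Prop :=
  {ae mu, forall x, I01 x -> P x}.

Definition ae_eq01 f g : Prop := almost_all01 (fun x => f x = g x).

Definition cmeasurable f : Prop :=
  measurable_fun I01 (@complex.Re R \o f) /\
  measurable_fun I01 (@complex.Im R \o f).

Definition cint f : R[i] :=
  Rintegral mu I01 (@complex.Re R \o f) +i*
  Rintegral mu I01 (@complex.Im R \o f).

Definition L1 : set (R -> R[i]) :=
  [set f : R -> R[i] | cmeasurable f /\
           mu.-integrable I01 (fun x => (Normc.normc (f x))%:E)].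

Definition L2 : set (R -> R[i]) :=
  [set f : R -> R[i] | cmeasurable f /\
           mu.-integrable I01 (fun x => (Normc.normc (f x) ^+ 2)%:E)].

Definition Linf : set (R -> R[i]) :=
  [set f : R -> R[i] | cmeasurable f /\
           exists M : R, almost_all01 (fun x => Normc.normc (f x) <= M)].

Definition Linv f : R -> R[i] := fun x => (f x)^-1.

(* Invertibility in the algebra L_oo(0,1).  As 0^-1 = 0 in R[i], it has to be
   required separately that f vanishes only on a null set. *)
Definition Linf_unit f : Prop :=
  [/\ Linf f, almost_all01 (fun x => f x != 0) & Linf (Linv f)].

Definition mean f : R[i] := cint f.

(* convergence in sigma(L_oo, L_1) *)
Definition weakstar_cvg (fn : nat -> R -> R[i]) f : Prop :=
  forall g, L1 g ->
    (fun n => cint (fun x => fn n x * g x) : R[i]^o) @ \oo -->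
    (cint (fun x => f x * g x) : R[i]^o).

Definition L2norm f : R :=
  Num.sqrt (Rintegral mu I01 (fun x => Normc.normc (f x) ^+ 2)).

Definition L2dot f g : R[i] := cint (fun x => f x * (g x)^*).

Definition smooth (g : R -> R) : Prop :=
  forall (n : nat) (x : R), derivable (derive1n n g) x 1.

(* C_c^oo(0,1) *)
Definition test_function : set (R -> R[i]) :=
  [set f : R -> R[i] |
     [/\ smooth (@complex.Re R \o f), smooth (@complex.Im R \o f) &
         exists K : set R, [/\ compact K, K `<=` I01 &
                               forall x, ~ K x -> f x = 0]]].

Definition cderive f : R -> R[i] := fun x =>
  derive1 (@complex.Re R \o f) x +i* derive1 (@complex.Im R \o f) x.

Definition is_wderiv u v : Prop :=
  forall phi, test_function phi ->
    cint (fun x => u x * cderive phi x) = - cint (fun x => v x * phi x).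

Definition H1 : set (R -> R[i]) :=
  [set u : R -> R[i] | L2 u /\ exists v, L2 v /\ is_wderiv u v].

(* A chosen representative of the weak derivative u' in L_2; meaningful for u
   in H^1, where it is unique up to a.e. equality. *)
Definition wderiv u : R -> R[i] :=
  xget (fun=> 0) [set v : R -> R[i] | L2 v /\ is_wderiv u v].

Definition H1norm u : R := Num.sqrt (L2norm u ^+ 2 + L2norm (wderiv u) ^+ 2).

(* H^1_0(0,1), the closure of C_c^oo(0,1) in H^1(0,1) *)
Definition H01 : set (R -> R[i]) :=
  [set u : R -> R[i] | H1 u /\
     exists phi : nat -> R -> R[i], (forall k, test_function (phi k)) /\
       (fun k => H1norm (fun x => phi k x - u x)) @ \oo --> (0 : R)].

(* Bounded linear functionals on H^1_0(0,1); only their values on H01 matter,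
   and boundedness makes them compatible with a.e. equality there. *)
Definition Hm1 : set ((R -> R[i]) -> R[i]) :=
  [set l : (R -> R[i]) -> R[i] |
           (forall (c : R[i]) u v, H01 u -> H01 v ->
              l (fun x => c * u x + v x) = c * l u + l v) /\
           exists C : R, forall u, H01 u -> Normc.normc (l u) <= C * H1norm u].

Definition weak_cvg_H01 (un : nat -> R -> R[i]) u : Prop :=
  forall l, Hm1 l -> (fun n => l (un n) : R[i]^o) @ \oo --> (l u : R[i]^o).

(* the multiplication operator f(m) *)
Definition mulop f q : R -> R[i] := fun x => f x * q x.

(* - g' as an element of H^{-1}: the functional phi |-> int g phi' *)
Definition neg_deriv g : (R -> R[i]) -> R[i] :=
  fun phi => cint (fun x => g x * wderiv phi x).

(* u in H^1_0 satisfies - (a u')' = l *)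
Definition solves (a : R -> R[i]) (l : (R -> R[i]) -> R[i]) u : Prop :=
  H01 u /\ forall phi, H01 phi -> neg_deriv (mulop a (wderiv u)) phi = l phi.

Definition g0 : set (R -> R[i]) :=
  [set q : R -> R[i] | L2 q /\ exists u, H01 u /\ is_wderiv u q].

(* iota_0^* h = r, where iota_0 : g_0 -> L_2 is the embedding *)
Definition iota0_adj h r : Prop :=
  g0 r /\ forall p, g0 p -> L2dot r p = L2dot h p.

(* the graph of iota_0^* a iota_0 : g_0 -> g_0 *)
Definition compression (a : R -> R[i]) q r : Prop :=
  g0 q /\ iota0_adj (mulop a q) r.

(* T, the graph of an operator on g_0, has a bounded two-sided inverse S *)
Definition continuously_invertible_g0
    (T : (R -> R[i]) -> (R -> R[i]) -> Prop) : Prop :=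
  exists S : (R -> R[i]) -> (R -> R[i]),
    [/\ forall r, g0 r -> T (S r) r,
        forall q r, T q r -> ae_eq01 (S r) q &
        exists C : R, forall r, g0 r -> L2norm (S r) <= C * L2norm r].

Definition MOmega : set (R -> R[i]) :=
  [set a : R -> R[i] | Linf a /\ continuously_invertible_g0 (compression a)].

Definition G_converges (an : nat -> R -> R[i]) (a : R -> R[i]) : Prop :=
  [/\ forall n, MOmega (an n), MOmega a &
      forall l, Hm1 l -> forall (un : nat -> R -> R[i]) u,
        (forall n, solves (an n) l (un n)) -> solves a l u ->
        weak_cvg_H01 un u].

End defs.

(* Main.v *)
Require Import Defs.
From mathcomp Require Import all_boot all_order all_algebra.
From mathcomp Require Import all_classical all_reals all_analysis.
From mathcomp Require Import complex.
From mathcomp Require Import measurable_realfun ring lra.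

(* A function q in L_2(0,1) lies in g_0 iff its mean vanishes.  Hence if u_n and u
   solve the equations with the same right-hand side and g := beta^-1 u', then
   alpha_n u_n' - g is constant, so u_n' = alpha_n^-1 (g + k_n) with k_n determined by
   the vanishing mean of u_n':
     k_n = - (int alpha_n^-1 g) / (int alpha_n^-1) --> - (int u') / (int beta) = 0.
   A functional on H^1_0 has the form u |-> int u' h with h in L_2 (Riesz), and weak-*
   convergence, tested with g h and h in L_1, gives
     int u_n' h = int alpha_n^-1 g h + k_n int alpha_n^-1 h --> int beta g h = int u' h. *)

(** Weak-* limits do not commute with products, so a product of two sequences converging only weakly
    would be out of reach. What saves dimension one is that the orthogonal complement of g_0 in L_2
    is the line of constants: all fluxes differ from one fixed g by scalars, and the coefficients
    enter linearly through their inverses. The same fact gives membership in M(Omega): for r in g_0,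
    iota_0^* a iota_0 q = r means that a q - r is constant, so q = a^-1 (r + k), and k exists and is
    unique once a^-1 has nonzero mean. The laborious half of the description of g_0 is to find u in
    H^1_0 with u' = q. It is done inside L_2, without absolutely continuous representatives. Norms
    are handled through their squares, and |f + g|^2 <= 2 |f|^2 + 2 |g|^2 replaces the triangle
    inequality, at the price of constants that are not sharp. *)

Set Implicit Arguments.
Unset Strict Implicit.
Unset Printing Implicit Defensive.

Import Order.TTheory GRing.Theory Num.Theory.
Import numFieldNormedType.Exports.

Local Open Scope classical_set_scope.
Local Open Scope complex_scope.
Local Open Scope ring_scope.

(** * Complex integrals and the spaces L_1, L_2, L_oo on (0,1) *)

Section complex_norm.
Context (R : realType).
Implicit Types z w : R[i].

Lemma normc_sqrE z : Normc.normc z ^+ 2 = complex.Re z ^+ 2 + complex.Im z ^+ 2.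
Proof. by case: z => a b /=; rewrite sqr_sqrtr// addr_ge0 ?sqr_ge0. Qed.

Lemma normc_ge0 z : 0 <= Normc.normc z.
Proof. by case: z => a b /=; exact: sqrtr_ge0. Qed.

Lemma normc_sqrt z : Normc.normc z = Num.sqrt (complex.Re z ^+ 2 + complex.Im z ^+ 2).
Proof. by case: z. Qed.

Lemma ReD z w : complex.Re (z + w) = complex.Re z + complex.Re w.
Proof. by case: z w => [a b] [c d]. Qed.

Lemma ImD z w : complex.Im (z + w) = complex.Im z + complex.Im w.
Proof. by case: z w => [a b] [c d]. Qed.

Lemma ReN z : complex.Re (- z) = - complex.Re z.
Proof. by case: z. Qed.

Lemma ImN z : complex.Im (- z) = - complex.Im z.
Proof. by case: z. Qed.

Lemma Re_mulc z w : complex.Re (z * w) =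
  complex.Re z * complex.Re w - complex.Im z * complex.Im w.
Proof. by case: z w => [a b] [c d]. Qed.

Lemma Im_mulc z w : complex.Im (z * w) =
  complex.Re z * complex.Im w + complex.Im z * complex.Re w.
Proof. by case: z w => [a b] [c d]. Qed.

Lemma complex_eq z w : complex.Re z = complex.Re w -> complex.Im z = complex.Im w -> z = w.
Proof. by case: z w => [a b] [c d] /= -> ->. Qed.

Lemma norm_Re_le z : `|complex.Re z| <= Normc.normc z.
Proof.
rewrite normc_sqrt -[leLHS]sqrtr_sqr ler_wsqrtr//.
by rewrite lerDl sqr_ge0.
Qed.

Lemma norm_Im_le z : `|complex.Im z| <= Normc.normc z.
Proof.
rewrite normc_sqrt -[leLHS]sqrtr_sqr ler_wsqrtr//.
by rewrite lerDr sqr_ge0.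
Qed.

Lemma normc_le_ReIm z : Normc.normc z <= `|complex.Re z| + `|complex.Im z|.
Proof.
rewrite -ler_sqr ?nnegrE ?addr_ge0 ?normc_ge0// normc_sqrE.
rewrite sqrrD !real_normK ?num_real//.
have := mulr_ge0 (normr_ge0 (complex.Re z)) (normr_ge0 (complex.Im z)).
lra.
Qed.

Lemma normc_conj z : Normc.normc z^* = Normc.normc z.
Proof. by rewrite !normc_sqrt; case: z => a b /=; rewrite sqrrN. Qed.

Lemma normcD_sqr_le z w :
  Normc.normc (z + w) ^+ 2 <= 2 * Normc.normc z ^+ 2 + 2 * Normc.normc w ^+ 2.
Proof.
rewrite !normc_sqrE ReD ImD.
have := sqr_ge0 (complex.Re z - complex.Re w).
have := sqr_ge0 (complex.Im z - complex.Im w).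
nra.
Qed.

(** Turning a complex integral to the positive real axis reduces |int f| <= int |f| to the
    monotonicity of a real integral; for z nonzero the rotation is conj z / |z|. *)
Lemma normc_rotation z : exists w, Normc.normc w = 1 /\ Normc.normc z = complex.Re (w * z).
Proof.
have [->|z0] := eqVneq z 0.
  by exists 1; rewrite Normc.normc1 mulr0 Normc.normc0.
have nz0 : Normc.normc z != 0.
  by apply: contra_neq z0; exact: Normc.eq0_normc.
exists (z^* / (Normc.normc z)%:C); split.
  by rewrite Normc.normcM Normc.normcV normc_conj /= expr0n /= addr0 sqrtr_sqr ger0_norm
    ?normc_ge0// divff.
rewrite mulrAC (_ : z^* * z = (Normc.normc z ^+ 2)%:C); last first.
  rewrite normc_sqrE; apply: complex_eq; rewrite /= ?Re_mulc ?Im_mulc; case: z {z0 nz0} => a b /=; ring.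
by rewrite -fmorphV -rmorphM /= expr2 mulfK.
Qed.

End complex_norm.

(** * Integration on (0,1): linearity, domination and the Cauchy-Schwarz inequality *)

Section integral01.
Context (R : realType).
Notation mu := (@lebesgue_measure R).
Notation I := (@I01 R).
Implicit Types (f g h : R -> R[i]) (a b : R -> R).

Lemma measurable_I01 : measurable (I : set (measurableTypeR R)).
Proof. exact: measurable_itv. Qed.

Lemma I01_measure : mu I = 1%E.
Proof. by rewrite /I01 lebesgue_measure_itv /= lte_fin ltr01 oppr0 adde0. Qed.

Let mI := measurable_I01.
Hint Resolve mI : core.

Lemma almost_all01_and (P Q : R -> Prop) :
  almost_all01 P -> almost_all01 Q -> almost_all01 (fun x => P x /\ Q x).
Proof.
by apply: (@filterS2 _ _ (ae_filter_ringOfSetsType mu)) => x hP hQ Ix; split; [exact: hP|exact: hQ].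
Qed.

Lemma almost_all01_mono (P Q : R -> Prop) :
  almost_all01 P -> (forall x, I x -> P x -> Q x) -> almost_all01 Q.
Proof.
move=> hP PQ; apply: (@filterS _ _ (ae_filter_ringOfSetsType mu) _ _ _ hP) => x hPx Ix.
exact: PQ (hPx Ix).
Qed.

Lemma almost_all01T (P : R -> Prop) : (forall x, I x -> P x) -> almost_all01 P.
Proof. by move=> h; apply: aeW => x; exact: h. Qed.

Lemma ae_eq01_sym f g : ae_eq01 f g -> ae_eq01 g f.
Proof. by move=> h; apply: almost_all01_mono h _. Qed.

Lemma ae_eq01_trans f g h : ae_eq01 f g -> ae_eq01 g h -> ae_eq01 f h.
Proof.
by move=> fg gh; apply: almost_all01_mono (almost_all01_and fg gh) _ => x _ [-> ->].
Qed.

Lemma integrable_bound a b : measurable_fun I a ->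
  mu.-integrable I (EFin \o b) -> (forall x, I x -> `|a x| <= b x) ->
  mu.-integrable I (EFin \o a).
Proof.
move=> ma ib ab; apply: (@le_integrable _ _ _ mu I mI (EFin \o a) _ _ _ ib).
  exact/measurable_EFinP.
by move=> x Ix /=; rewrite lee_fin (le_trans (ab x Ix))// ler_norm.
Qed.

Lemma integrable_bound_ae a b : measurable_fun I a -> measurable_fun I b ->
  mu.-integrable I (EFin \o b) -> almost_all01 (fun x => `|a x| <= b x) ->
  mu.-integrable I (EFin \o a).
Proof.
move=> ma mb ib ab; apply/integrableP; split; first exact/measurable_EFinP.
apply: le_lt_trans (proj2 (integrableP _ _ _ ib)).
apply: ae_ge0_le_integral => //=.
- by do 2 apply: measurableT_comp => //.
- by do 2 apply: measurableT_comp => //.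
- by apply: (@filterS _ _ (ae_filter_ringOfSetsType mu) _ _ _ ab) => x h Ix;
    rewrite lee_fin (le_trans (h Ix))// ler_norm.
Qed.

Lemma integrable_add a b : mu.-integrable I (EFin \o a) -> mu.-integrable I (EFin \o b) ->
  mu.-integrable I (EFin \o (fun x => a x + b x)).
Proof. by move=> ia ib; have := integrableD mI ia ib; apply: eq_integrable. Qed.

Lemma integrable_opp a : mu.-integrable I (EFin \o a) ->
  mu.-integrable I (EFin \o (fun x => - a x)).
Proof. by move=> ia; have := integrableN ia; apply: eq_integrable. Qed.

Lemma integrable_scale (c : R) a : mu.-integrable I (EFin \o a) ->
  mu.-integrable I (EFin \o (fun x => c * a x)).
Proof. by move=> ia; have := integrableZl mI c ia; apply: eq_integrable. Qed.

Lemma integrable_measurable a : mu.-integrable I (EFin \o a) -> measurable_fun I a.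
Proof. by move=> /integrableP [/measurable_EFinP]. Qed.

Lemma integrable_const (c : R) : mu.-integrable I (EFin \o (fun=> c)).
Proof.
apply: measurable_bounded_integrable => //; first by rewrite /= I01_measure ltry.
by exists `|c|; split; rewrite ?num_real// => M /ltW; move=> h x _.
Qed.

Lemma Rintegral01_cst (c : R) : Rintegral mu I (fun=> c) = c.
Proof. by rewrite Rintegral_cst//= I01_measure mulr1. Qed.

Lemma Rintegral_ae a b : measurable_fun I a -> measurable_fun I b ->
  almost_all01 (fun x => a x = b x) -> Rintegral mu I a = Rintegral mu I b.
Proof.
move=> ma mb ab; congr fine; apply: ae_eq_integral => //; try exact/measurable_EFinP.
by apply: (@filterS _ _ (ae_filter_ringOfSetsType mu) _ _ _ ab) => x h /h ->.
Qed.

Lemma le_Rintegral_ae a b : mu.-integrable I (EFin \o a) -> mu.-integrable I (EFin \o b) ->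
  almost_all01 (fun x => a x <= b x) -> Rintegral mu I a <= Rintegral mu I b.
Proof.
move=> ia ib ab.
have ma := integrable_measurable ia; have mb := integrable_measurable ib.
(* Replacing b by max(a, b), equal to it almost everywhere, makes the inequality hold at every
   point. *)
have iab : mu.-integrable I (EFin \o (fun x => Num.max (a x) (b x))).
  apply: (@integrable_bound _ (fun x => `|a x| + `|b x|)).
  - exact: measurable_maxr.
  - by apply: integrable_add; apply: integrable_norm.
  - move=> x _; rewrite maxEle; case: ifP => _; first by rewrite lerDr.
    by rewrite lerDl.
rewrite (@Rintegral_ae b (fun x => Num.max (a x) (b x)))//; last 2 first.
- exact: integrable_measurable.
- by apply: almost_all01_mono ab _ => x _ /max_idPr ->.
by apply: le_Rintegral => // x _; rewrite le_max lexx.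
Qed.

Lemma cmeasurableD f g : cmeasurable f -> cmeasurable g ->
  cmeasurable (fun x => f x + g x).
Proof.
move=> [rf jf] [rg jg]; split.
  by rewrite (_ : _ \o _ = fun x => complex.Re (f x) + complex.Re (g x));
    [exact: measurable_funD|apply/funext => x /=; rewrite ReD].
by rewrite (_ : _ \o _ = fun x => complex.Im (f x) + complex.Im (g x));
    [exact: measurable_funD|apply/funext => x /=; rewrite ImD].
Qed.

Lemma cmeasurableM f g : cmeasurable f -> cmeasurable g ->
  cmeasurable (fun x => f x * g x).
Proof.
move=> [rf jf] [rg jg]; split.
  rewrite (_ : _ \o _ = fun x => complex.Re (f x) * complex.Re (g x)
     - complex.Im (f x) * complex.Im (g x)); last by apply/funext => x /=; rewrite Re_mulc.
  by apply: measurable_funB; exact: measurable_funM.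
rewrite (_ : _ \o _ = fun x => complex.Re (f x) * complex.Im (g x)
     + complex.Im (f x) * complex.Re (g x)); last by apply/funext => x /=; rewrite Im_mulc.
by apply: measurable_funD; exact: measurable_funM.
Qed.

Lemma cmeasurable_conj f : cmeasurable f -> cmeasurable (fun x => (f x)^*).
Proof.
move=> [rf jf]; split.
  by rewrite (_ : _ \o _ = @complex.Re R \o f)//; apply/funext => x /=; case: (f x).
rewrite (_ : _ \o _ = fun x => - complex.Im (f x)); last by apply/funext => x /=; case: (f x).
exact: measurableT_comp.
Qed.

Lemma cmeasurable_cst (c : R[i]) : cmeasurable (fun=> c : R[i]).
Proof. by split; exact: measurable_cst. Qed.

Lemma cmeasurable_normc f : cmeasurable f -> measurable_fun I (fun x => Normc.normc (f x)).
Proof.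
move=> [rf jf].
rewrite (_ : (fun _ => _) = fun x => Num.sqrt (complex.Re (f x) ^+ 2 + complex.Im (f x) ^+ 2));
  last by apply/funext => x; rewrite normc_sqrt.
apply: measurableT_comp.
  by apply: continuous_measurable_fun; exact: sqrt_continuous.
by apply: measurable_funD; exact: measurable_funX.
Qed.

Lemma cmeasurable_normc2 f : cmeasurable f ->
  measurable_fun I (fun x => Normc.normc (f x) ^+ 2).
Proof. by move=> mf; apply: measurable_funX; exact: cmeasurable_normc. Qed.

Lemma L1P f : L1 f <-> mu.-integrable I (EFin \o (@complex.Re R \o f)) /\
  mu.-integrable I (EFin \o (@complex.Im R \o f)).
Proof.
split=> [[mf i]|[ir ii]].
  split.
    by apply: (integrable_bound (proj1 mf) i) => x _; exact: norm_Re_le.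
  by apply: (integrable_bound (proj2 mf) i) => x _; exact: norm_Im_le.
have mf : cmeasurable f by split; exact: integrable_measurable.
split=> //; apply: (@integrable_bound _ (fun x => `|complex.Re (f x)| + `|complex.Im (f x)|)).
- exact: cmeasurable_normc.
- by apply: integrable_add; exact: integrable_norm.
- by move=> x _; rewrite ger0_norm ?normc_ge0// normc_le_ReIm.
Qed.

Lemma L1_cmeasurable f : L1 f -> cmeasurable f.
Proof. by case. Qed.

Lemma L2_cmeasurable f : L2 f -> cmeasurable f.
Proof. by case. Qed.

Lemma L1D f g : L1 f -> L1 g -> L1 (fun x => f x + g x).
Proof.
move=> /L1P [rf jf] /L1P [rg jg]; apply/L1P; split.
  by rewrite (_ : _ \o _ = fun x => complex.Re (f x) + complex.Re (g x));
    [exact: integrable_add|apply/funext => x /=; rewrite ReD].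
by rewrite (_ : _ \o _ = fun x => complex.Im (f x) + complex.Im (g x));
  [exact: integrable_add|apply/funext => x /=; rewrite ImD].
Qed.

Lemma L1Z (c : R[i]) f : L1 f -> L1 (fun x => c * f x).
Proof.
move=> /L1P [rf jf]; apply/L1P; split.
  rewrite (_ : _ \o _ = fun x => complex.Re c * complex.Re (f x) +
    (- complex.Im c) * complex.Im (f x));
    [|by apply/funext => x /=; rewrite Re_mulc mulNr].
  by apply: integrable_add; exact: integrable_scale.
rewrite (_ : _ \o _ = fun x => complex.Re c * complex.Im (f x) +
    complex.Im c * complex.Re (f x));
    [|by apply/funext => x /=; rewrite Im_mulc].
by apply: integrable_add; exact: integrable_scale.
Qed.

Lemma L1N f : L1 f -> L1 (fun x => - f x).
Proof.
move=> /(L1Z (-1)) h.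
by rewrite (_ : (fun _ => _) = fun x => -1 * f x)//; apply/funext => x; rewrite mulN1r.
Qed.

Lemma cintD f g : L1 f -> L1 g -> cint (fun x => f x + g x) = cint f + cint g.
Proof.
move=> /L1P [rf jf] /L1P [rg jg]; apply: complex_eq.
  rewrite ReD /= -RintegralD//.
  by congr Rintegral; apply/funext => x /=; rewrite ReD.
rewrite ImD /= -RintegralD//.
by congr Rintegral; apply/funext => x /=; rewrite ImD.
Qed.

Lemma cintZ (c : R[i]) f : L1 f -> cint (fun x => c * f x) = c * cint f.
Proof.
move=> /L1P [rf jf]; apply: complex_eq.
  rewrite Re_mulc /= -!RintegralZl// -RintegralB//; try exact: integrable_scale.
  by congr Rintegral; apply/funext => x /=; rewrite Re_mulc.
rewrite Im_mulc /= -!RintegralZl// -RintegralD//; try exact: integrable_scale.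
by congr Rintegral; apply/funext => x /=; rewrite Im_mulc.
Qed.

Lemma cintN f : L1 f -> cint (fun x => - f x) = - cint f.
Proof.
move=> h; rewrite -mulN1r -cintZ//.
by congr cint; apply/funext => x; rewrite mulN1r.
Qed.

Lemma cintB f g : L1 f -> L1 g -> cint (fun x => f x - g x) = cint f - cint g.
Proof. by move=> hf hg; rewrite cintD ?cintN//; exact: L1N. Qed.

Lemma cint_cst (c : R[i]) : cint (fun=> c : R[i]) = c.
Proof. by rewrite /cint; apply: complex_eq => /=; rewrite -[RHS]Rintegral01_cst. Qed.

Lemma cint_ae f g : cmeasurable f -> cmeasurable g -> ae_eq01 f g -> cint f = cint g.
Proof.
move=> [rf jf] [rg jg] fg; apply: complex_eq => /=; apply: Rintegral_ae => //;
by apply: almost_all01_mono fg _ => x _ /= ->.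
Qed.

Lemma normc_cint_le f : L1 f ->
  Normc.normc (cint f) <= Rintegral mu I (fun x => Normc.normc (f x)).
Proof.
move=> Lf; have [w [w1 ->]] := normc_rotation (cint f).
rewrite -cintZ//; have /L1P [ir _] := L1Z w Lf.
apply: le_Rintegral => //; first by case: Lf.
move=> x _ /=; apply: le_trans (ler_norm _) _; apply: le_trans (norm_Re_le _) _.
by rewrite Normc.normcM w1 mul1r.
Qed.

(** The working quantity instead of the norm: limits, comparison of integrals and linear arithmetic
    apply to it without square roots. *)
Definition L2sqr f : R := Rintegral mu I (fun x => Normc.normc (f x) ^+ 2).

Lemma L2sqr_ge0 f : 0 <= L2sqr f.
Proof. by apply: Rintegral_ge0 => x _; exact: sqr_ge0. Qed.

Lemma sqr_L2norm f : L2norm f ^+ 2 = L2sqr f.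
Proof. by rewrite sqr_sqrtr// L2sqr_ge0. Qed.

Lemma L2norm_ge0 f : 0 <= L2norm f.
Proof. exact: sqrtr_ge0. Qed.

Lemma L2sqr_ae f g : cmeasurable f -> cmeasurable g -> ae_eq01 f g -> L2sqr f = L2sqr g.
Proof.
move=> mf mg fg; apply: Rintegral_ae; try exact: cmeasurable_normc2.
by apply: almost_all01_mono fg _ => x _ ->.
Qed.

Lemma L2D f g : L2 f -> L2 g -> L2 (fun x => f x + g x).
Proof.
move=> [mf f2] [mg g2]; split; first exact: cmeasurableD.
apply: (@integrable_bound _ (fun x => 2 * Normc.normc (f x) ^+ 2 + 2 * Normc.normc (g x) ^+ 2)).
- by apply: cmeasurable_normc2; exact: cmeasurableD.
- by apply: integrable_add; exact: integrable_scale.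
- by move=> x _; rewrite ger0_norm ?sqr_ge0// normcD_sqr_le.
Qed.

Lemma Linf_mul_L2 f g : Linf f -> L2 g -> L2 (fun x => f x * g x).
Proof.
move=> [mf [M fM]] [mg g2]; have mfg := cmeasurableM mf mg; split=> //.
apply: (@integrable_bound_ae _ (fun x => M ^+ 2 * Normc.normc (g x) ^+ 2)).
- exact: cmeasurable_normc2.
- by apply: measurable_funM => //; exact: cmeasurable_normc2.
- exact: integrable_scale.
- apply: almost_all01_mono fM _ => x _ fxM.
  rewrite ger0_norm ?sqr_ge0// Normc.normcM exprMn ler_wpM2r ?sqr_ge0//.
  by rewrite ler_sqr ?nnegrE ?normc_ge0// (le_trans (normc_ge0 _) fxM).
Qed.

Lemma L2sqr_Linf_mul f g (M : R) : Linf f -> L2 g ->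
  almost_all01 (fun x => Normc.normc (f x) <= M) ->
  L2sqr (fun x => f x * g x) <= M ^+ 2 * L2sqr g.
Proof.
move=> Lf Lg fM; have Lfg := Linf_mul_L2 Lf Lg.
rewrite /L2sqr -RintegralZl//; last by case: Lg.
apply: le_Rintegral_ae; [by case: Lfg|by apply: integrable_scale; case: Lg|].
apply: almost_all01_mono fM _ => x _ fxM.
rewrite Normc.normcM exprMn ler_wpM2r ?sqr_ge0//.
by rewrite ler_sqr ?nnegrE ?normc_ge0// (le_trans (normc_ge0 _) fxM).
Qed.

Lemma Linf_mul_L1 f g : Linf f -> L1 g -> L1 (fun x => f x * g x).
Proof.
move=> [mf [M fM]] [mg g2]; have mfg := cmeasurableM mf mg; split=> //.
apply: (@integrable_bound_ae _ (fun x => M * Normc.normc (g x))).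
- exact: cmeasurable_normc.
- by apply: measurable_funM => //; exact: cmeasurable_normc.
- exact: integrable_scale.
- apply: almost_all01_mono fM _ => x _ fxM.
  by rewrite ger0_norm ?normc_ge0// Normc.normcM ler_wpM2r ?normc_ge0.
Qed.

Lemma Linf_cst (c : R[i]) : Linf (fun=> c : R[i]).
Proof.
split; first exact: cmeasurable_cst.
by exists (Normc.normc c); apply: almost_all01T.
Qed.

Lemma L2_cst (c : R[i]) : L2 (fun=> c : R[i]).
Proof. by split; [exact: cmeasurable_cst|exact: integrable_const]. Qed.

Lemma L2sqr_cst (c : R[i]) : L2sqr (fun=> c : R[i]) = Normc.normc c ^+ 2.
Proof. exact: Rintegral01_cst. Qed.

Lemma L2Z (c : R[i]) f : L2 f -> L2 (fun x => c * f x).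
Proof. exact/Linf_mul_L2/Linf_cst. Qed.

Lemma L2N f : L2 f -> L2 (fun x => - f x).
Proof.
move=> /(L2Z (-1)) h.
by rewrite (_ : (fun _ => _) = fun x => -1 * f x)//; apply/funext => x; rewrite mulN1r.
Qed.

Lemma L2B f g : L2 f -> L2 g -> L2 (fun x => f x - g x).
Proof. by move=> hf hg; apply: L2D => //; exact: L2N. Qed.

Lemma L2_conj f : L2 f -> L2 (fun x => (f x)^*).
Proof.
move=> [mf f2]; split; first exact: cmeasurable_conj.
by apply: eq_integrable f2 => // x _; rewrite normc_conj.
Qed.

Lemma L2sqr_conj f : L2sqr (fun x => (f x)^*) = L2sqr f.
Proof. by congr Rintegral; apply/funext => x; rewrite normc_conj. Qed.

Lemma L2sqrZ (c : R[i]) f : L2 f -> L2sqr (fun x => c * f x) = Normc.normc c ^+ 2 * L2sqr f.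
Proof.
move=> [_ f2]; rewrite /L2sqr -RintegralZl//.
by congr Rintegral; apply/funext => x; rewrite Normc.normcM exprMn.
Qed.

Lemma L2sqrN f : L2sqr (fun x => - f x) = L2sqr f.
Proof. by congr Rintegral; apply/funext => x; rewrite normcN. Qed.

Lemma L2sqrBC f g : L2sqr (fun x => f x - g x) = L2sqr (fun x => g x - f x).
Proof.
by rewrite -L2sqrN; congr Rintegral; apply/funext => x; rewrite opprB.
Qed.

Lemma L2sqrD_le f g : L2 f -> L2 g ->
  L2sqr (fun x => f x + g x) <= 2 * L2sqr f + 2 * L2sqr g.
Proof.
move=> Lf Lg; have [_ ifg] := L2D Lf Lg; case: Lf Lg => [mf f2] [mg g2].
rewrite /L2sqr -!RintegralZl// -RintegralD//; try exact: integrable_scale.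
apply: le_Rintegral => //; first by apply: integrable_add; exact: integrable_scale.
by move=> x _; exact: normcD_sqr_le.
Qed.

Lemma L2_mul_L1 f g : L2 f -> L2 g -> L1 (fun x => f x * g x).
Proof.
move=> [mf f2] [mg g2]; have mfg := cmeasurableM mf mg; split=> //.
apply: (@integrable_bound _ (fun x => Normc.normc (f x) ^+ 2 + Normc.normc (g x) ^+ 2)).
- exact: cmeasurable_normc.
- exact: integrable_add.
- move=> x _; rewrite ger0_norm ?normc_ge0// Normc.normcM.
  by have := sqr_ge0 (Normc.normc (f x) - Normc.normc (g x));
    have := normc_ge0 (f x); have := normc_ge0 (g x); nra.
Qed.

Lemma L2_L1 f : L2 f -> L1 f.
Proof.
move=> /L2_mul_L1 /(_ (L2_cst 1)).
by rewrite (_ : (fun _ => _) = f)//; apply/funext => x; rewrite mulr1.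
Qed.

(** The optimal weight is s = x / a. If a = 0 < x, the weight (b + 1) / x gives 2 x <= x b / (b + 1)
    <= x, a contradiction. *)
Lemma le_sqr_of_weighted (x a b : R) : 0 <= x -> 0 <= a -> 0 <= b ->
  (forall s, 0 < s -> 2 * x <= s * a + s^-1 * b) -> x ^+ 2 <= a * b.
Proof.
rewrite le_eqVlt => /predU1P[<- a0 b0 _|x0 a0 b0 h]; first by rewrite expr0n/= mulr_ge0.
move: a0; rewrite le_eqVlt => /predU1P[a0|a0].
  have s0 : 0 < (b + 1) / x by rewrite divr_gt0// ltr_wpDl.
  have := h _ s0; rewrite -a0 mulr0 add0r invf_div mulrAC -mulrA.
  have : b / (b + 1) <= 1 by rewrite ler_pdivrMr ?mul1r ?ltr_wpDl// lerDl.
  move: (b / (b + 1)) => t t1 h2; nra.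
have s0 : 0 < x / a by rewrite divr_gt0.
have := h _ s0; rewrite divfK ?gt_eqF// invf_div => h2.
have : x <= a / x * b by lra.
by rewrite mulrAC ler_pdivlMr// -expr2.
Qed.

(** Integrates the pointwise 2 |f g| <= s |f|^2 + s^-1 |g|^2 for every s > 0. The modulus stands
    inside the integral because the case g = 1, a bound of int |f|, serves completeness and the
    Poincare inequality. *)
Lemma Cauchy_Schwarz f g : L2 f -> L2 g ->
  Rintegral mu I (fun x => Normc.normc (f x * g x)) ^+ 2 <= L2sqr f * L2sqr g.
Proof.
move=> Lf Lg; have [_ ifg] := L2_mul_L1 Lf Lg; case: Lf Lg => [mf f2] [mg g2].
apply: le_sqr_of_weighted; rewrite ?L2sqr_ge0//.
  by apply: Rintegral_ge0 => x _; exact: normc_ge0.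
move=> s s0; rewrite /L2sqr -!RintegralZl// -RintegralD//; try exact: integrable_scale.
apply: le_Rintegral => //; first exact: integrable_scale.
  by apply: integrable_add; exact: integrable_scale.
move=> x _; rewrite Normc.normcM.
have := sqr_ge0 (s * Normc.normc (f x) - Normc.normc (g x)).
move: (Normc.normc (f x)) (Normc.normc (g x)) => u v h.
rewrite -(ler_pM2l s0) mulrDr [s * (s^-1 * _)]mulrA divff ?gt_eqF// mul1r; nra.
Qed.

Lemma normc_cint_mul_le f g : L2 f -> L2 g ->
  Normc.normc (cint (fun x => f x * g x)) ^+ 2 <= L2sqr f * L2sqr g.
Proof.
move=> Lf Lg; apply: le_trans (Cauchy_Schwarz Lf Lg).
by rewrite ler_sqr ?nnegrE ?normc_ge0// ?normc_cint_le//;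
  [exact: L2_mul_L1|apply: Rintegral_ge0 => x _; exact: normc_ge0].
Qed.

Lemma normc_cint_L2_le f : L2 f -> Normc.normc (cint f) ^+ 2 <= L2sqr f.
Proof.
move=> Lf; have := normc_cint_mul_le Lf (L2_cst 1).
rewrite L2sqr_cst Normc.normc1 expr1n mulr1.
by rewrite (_ : (fun _ => _) = f)//; apply/funext => x; rewrite mulr1.
Qed.

Lemma L2sqr_eq0 f : L2 f -> L2sqr f = 0 -> ae_eq01 f (fun=> 0).
Proof.
move=> [mf f2] f0.
have m2 := cmeasurable_normc2 mf.
have h : ae_eq mu I (fun x => (Normc.normc (f x) ^+ 2)%:E) (cst 0%E).
  apply/(ae_eq_integral_abs mu mI); first exact/measurable_EFinP.
  move: f0; rewrite /L2sqr /Rintegral => f0.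
  rewrite -[RHS]/(0%:E) -f0 fineK; last exact: integrable_fin_num.
  by apply: eq_integral => x _; rewrite gee0_abs// lee_fin sqr_ge0.
apply: (@filterS _ _ (ae_filter_ringOfSetsType mu) _ _ _ h) => x /[apply] -[] /eqP.
by rewrite sqrf_eq0 => /eqP /Normc.eq0_normc.
Qed.

End integral01.

(** * Completeness of L_2(0,1) and Riesz representation *)

Section completeness.
Context (R : realType).
Notation mu := (@lebesgue_measure R).
Notation I := (@I01 R).
Implicit Types (f g h : R -> R[i]) (a : nat -> R -> R).

Let mI := @measurable_I01 R.
Hint Resolve mI : core.

Lemma is_cvg_abs_increments (u : nat -> R) :
  (\big[+%E/0]_(0 <= k <oo) `|u k.+1 - u k|%:E \is a fin_num)%E -> cvgn u.
Proof.
move=> ufin; pose v k := u k.+1 - u k.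
have cv : cvgn (series v).
  apply: normed_cvg; apply: nondecreasing_is_cvgn.
    by apply: nondecreasing_series => n _ _ /=.
  exists (fine (\big[+%E/0]_(0 <= k <oo) `|u k.+1 - u k|%:E)%E) => _ [n _ <-].
  rewrite -lee_fin fineK// /series/= -sumEFin.
  by apply: nneseries_lim_ge => k _ _; rewrite lee_fin.
have -> : u = (fun n => u 0%N + series v n).
  by apply/funext => n; rewrite /series /= telescope_sumr// addrC subrK.
by apply: is_cvgD => //; exact: is_cvg_cst.
Qed.

(** The integrals of the increments sum to at most 1, so the increments are absolutely summable
    almost everywhere. *)
Lemma ae_cvg_of_geometric a :
  (forall k, mu.-integrable I (EFin \o a k)) ->
  (forall k, Rintegral mu I (fun x => `|a k.+1 x - a k x|) <= 1 / (2 ^ k.+1)%:R) ->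
  exists2 b : R -> R, measurable_fun I b &
    almost_all01 (fun x => (fun k => a k x) @ \oo --> b x).
Proof.
move=> ia da.
have ma k : measurable_fun I (a k) by exact: integrable_measurable.
(* The limsup is defined and measurable everywhere, so no exceptional set enters the choice of the
   limit; [fine] only makes it real-valued. *)
exists (fun x => fine (limn_esup (fun k => (a k x)%:E))).
  apply: measurableT_comp; first exact: fine_measurable.
  by apply: measurable_fun_limn_esup => k; exact/measurable_EFinP.
pose d k x : \bar R := `|a k.+1 x - a k x|%:E.
have id k : mu.-integrable I (d k).
  by apply: integrable_norm; apply: integrable_add => //; exact: integrable_opp.
have md k : measurable_fun I (d k) by exact: measurable_int (id k).
have d0 k x : I x -> (0 <= d k x)%E by move=> _; rewrite lee_fin.
have iG : mu.-integrable I (fun x => \big[+%E/0]_(0 <= k <oo) d k x)%E.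
  apply/integrableP; split.
    by apply: (@ge0_emeasurable_sum _ _ _ I d xpredT) => // k x Ix _; exact: d0.
  have -> : (\int[mu]_(x in I) `|\big[+%E/0]_(0 <= k <oo) d k x| =
      \int[mu]_(x in I) \big[+%E/0]_(0 <= k <oo) d k x)%E.
    apply: eq_integral => x /[!inE] Ix; rewrite gee0_abs//.
    by apply: nneseries_ge0 => k _ _; exact: d0.
  rewrite integral_nneseries//; apply: le_lt_trans (ltry 1).
  apply: le_trans (epsilon_trick0 xpredT ler01); apply: lee_nneseries => [k _ _|k _].
    by apply: integral_ge0 => x; exact: d0.
  rewrite -(fineK (integrable_fin_num mI (id k))) lee_fin; exact: da.
apply: (@filterS _ _ (ae_filter_ringOfSetsType mu) _ _ _ (integrable_ae mI iG)) => x h Ix.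
have /cvg_ex[l ul] := @is_cvg_abs_increments (fun k => a k x) (h Ix).
have ul' : (a k x)%:E @[k --> \oo] --> l%:E by apply: cvg_EFin; [exact: nearW|exact: ul].
by rewrite (cvg_limn_einf_sup ul').2.
Qed.

Lemma measurable_limn_einf (F : nat -> R -> \bar R) :
  (forall n, measurable_fun I (F n)) -> measurable_fun I (fun x => limn_einf (F^~ x)).
Proof.
move=> mF.
have -> : (fun x => limn_einf (F^~ x)) = (fun x => - limn_esup (fun n => - F n x))%E.
  apply/funext => x; rewrite -limn_einfN; congr limn_einf.
  by apply/funext => n /=; rewrite oppeK.
apply: measurableT_comp => //; apply: measurable_fun_limn_esup => n.
by apply: measurableT_comp => //.
Qed.

Lemma limn_einf_le (u : nat -> \bar R) (l : \bar R) :
  (forall n, u n <= l)%E -> (limn_einf u <= l)%E.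
Proof.
move=> ul; rewrite limn_einf_lim; apply: lime_le.
  by apply: ereal_nondecreasing_is_cvgn => m n; exact: nondecreasing_einfs.
by apply: nearW => n; apply: le_trans (ul n); apply: ereal_inf_lbound; exists n => /=.
Qed.

(** Convergence of both parts makes |q_k|^2 converge almost everywhere, and Fatou's lemma yields the
    membership of the limit in L_2 together with the bound, with no dominating function. *)
Lemma L2_Fatou (q : nat -> R -> R[i]) g (e : R) : (forall k, L2 (q k)) -> cmeasurable g ->
  almost_all01 (fun x => (fun k => complex.Re (q k x)) @ \oo --> complex.Re (g x)) ->
  almost_all01 (fun x => (fun k => complex.Im (q k x)) @ \oo --> complex.Im (g x)) ->
  (forall k, L2sqr (q k) <= e) -> L2 g /\ L2sqr g <= e.
Proof.
move=> Lq mg reg img qe.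
have e0 : 0 <= e by apply: le_trans (qe 0%N); exact: L2sqr_ge0.
have h : (\int[mu]_(x in I) (Normc.normc (g x) ^+ 2)%:E <= e%:E)%E.
  pose F k x : \bar R := (Normc.normc (q k x) ^+ 2)%:E.
  have mF k : measurable_fun I (F k).
    by apply/measurable_EFinP; apply: cmeasurable_normc2; case: (Lq k).
  have -> : (\int[mu]_(x in I) (Normc.normc (g x) ^+ 2)%:E =
             \int[mu]_(x in I) limn_einf (F^~ x))%E.
    apply: ae_eq_integral => //.
    - by apply/measurable_EFinP; exact: cmeasurable_normc2.
    - exact: measurable_limn_einf.
    - apply: (@filterS2 _ _ (ae_filter_ringOfSetsType mu) _ _ _ _ reg img) => x hr hi Ix.
      have Fg : F k x @[k --> \oo] --> (Normc.normc (g x) ^+ 2)%:E.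
        apply: cvg_EFin; first exact: nearW.
        have -> : fine \o F^~ x = (fun k => complex.Re (q k x) * complex.Re (q k x) +
            complex.Im (q k x) * complex.Im (q k x)).
          by apply/funext => k /=; rewrite normc_sqrE !expr2.
        by rewrite normc_sqrE !expr2; apply: cvgD; apply: cvgM; auto.
      by rewrite (cvg_limn_einf_sup Fg).1.
  apply: le_trans; first by apply: fatou => // n x _; rewrite lee_fin sqr_ge0.
  apply: limn_einf_le => n.
  rewrite -(@fineK _ (\int[mu]_(x in I) F n x)%E) ?lee_fin; first exact: qe.
  by apply: integrable_fin_num => //; case: (Lq n).
have L : L2 g.
  split=> //; apply/integrableP; split.
    by apply/measurable_EFinP; exact: cmeasurable_normc2.
  apply: le_lt_trans (ltry e); apply: le_trans h.
  by rewrite le_eqVlt; apply/orP; left; apply/eqP; apply: eq_integral => x _;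
    rewrite gee0_abs// lee_fin sqr_ge0.
split=> //; rewrite -lee_fin /L2sqr /Rintegral fineK//.
by apply: integrable_fin_num => //; case: L.
Qed.

Definition L2_Cauchy (q : nat -> R -> R[i]) := forall e : R, 0 < e ->
  exists K, forall j k, (K <= j)%N -> (K <= k)%N -> L2sqr (fun x => q j x - q k x) <= e.

(** A fast subsequence converges almost everywhere, and Fatou's lemma upgrades this to L_2
    convergence of the whole sequence. *)
Lemma L2_complete (q : nat -> R -> R[i]) : (forall k, L2 (q k)) -> L2_Cauchy q ->
  exists2 g, L2 g & (fun k => L2sqr (fun x => q k x - g x)) @ \oo --> (0 : R).
Proof.
move=> Lq Cq.
(* Squared, because Cauchy-Schwarz against the constant 1 bounds the square of the L_1 norm by
   [L2sqr]; the L_1 increments are then at most 2^-(k+1). *)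
pose eps k : R := (1 / (2 ^ k.+1)%:R) ^+ 2.
have pow0 k : 0 < 1 / (2 ^ k.+1)%:R :> R by rewrite divr_gt0// ltr0n expn_gt0.
have eps0 k : 0 < eps k by rewrite exprn_gt0.
have /choice[s0 s0P] : forall k, exists K, forall i j, (K <= i)%N -> (K <= j)%N ->
  L2sqr (fun x => q i x - q j x) <= eps k by move=> k; exact: Cq.
(* Summing the thresholds and adding k yields an index that dominates [s0 k], grows with k and is at
   least k, without a recursive choice. *)
pose s k := (\sum_(i < k.+1) s0 i + k)%N.
have s0s k : (s0 k <= s k)%N by rewrite /s big_ord_recr/= addnAC leq_addl.
have sS k : (s k <= s k.+1)%N by rewrite /s (big_ord_recr k.+1)/= leq_add// leq_addr.
have ks k : (k <= s k)%N by rewrite leq_addl.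
have incr k : Rintegral mu I (fun x => Normc.normc (q (s k.+1) x - q (s k) x)) <= 1 / (2 ^ k.+1)%:R.
  have LB : L2 (fun x => q (s k.+1) x - q (s k) x) by exact: L2B.
  rewrite -ler_sqr ?nnegrE ?(ltW (pow0 k))//; last first.
    by apply: Rintegral_ge0 => x _; exact: normc_ge0.
  have := Cauchy_Schwarz LB (L2_cst 1); rewrite L2sqr_cst Normc.normc1 expr1n mulr1.
  under [X in Rintegral _ _ X]eq_fun do rewrite mulr1.
  move=> /le_trans; apply; apply: s0P => //; exact: leq_trans (sS k).
have Lint k : L1 (q k) by exact: L2_L1.
have LB k : L1 (fun x => q (s k.+1) x - q (s k) x) by apply: L1D => //; exact: L1N.
have [br mbr brP] : exists2 b : R -> R, measurable_fun I b &
    almost_all01 (fun x => (fun k => complex.Re (q (s k) x)) @ \oo --> b x).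
  apply: ae_cvg_of_geometric => k; first by have /L1P[] := Lint (s k).
  apply: le_trans (incr k); apply: le_Rintegral => //; last 2 first.
  - by case: (LB k).
  - by move=> x _; rewrite -ReN -ReD norm_Re_le.
  have /L1P[] := LB k => /integrable_norm i _; apply: eq_integrable i => // x _.
  by rewrite /= ReD ReN.
have [bi mbi biP] : exists2 b : R -> R, measurable_fun I b &
    almost_all01 (fun x => (fun k => complex.Im (q (s k) x)) @ \oo --> b x).
  apply: ae_cvg_of_geometric => k; first by have /L1P[] := Lint (s k).
  apply: le_trans (incr k); apply: le_Rintegral => //; last 2 first.
  - by case: (LB k).
  - by move=> x _; rewrite -ImN -ImD norm_Im_le.
  have /L1P[] := LB k => _ /integrable_norm i; apply: eq_integrable i => // x _.
  by rewrite /= ImD ImN.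
pose g x := br x +i* bi x.
have mg : cmeasurable g by [].
(* For fixed k, Fatou's lemma is applied to the differences with [q k] along the subsequence; the
   shift by K keeps all its indices beyond K. *)
have lim e : 0 < e -> exists K, forall k, (K <= k)%N ->
    L2 (fun x => g x - q k x) /\ L2sqr (fun x => g x - q k x) <= e.
  move=> e0; have [K KP] := Cq _ e0; exists K => k Kk.
  apply: (@L2_Fatou (fun n x => q (s (n + K)%N) x - q k x)).
  - by move=> n; exact: L2B.
  - by have := L1_cmeasurable (L1N (Lint k)); apply: cmeasurableD.
  - apply: almost_all01_mono brP _ => x _ h.
    have -> : (fun n => complex.Re (q (s (n + K)%N) x - q k x)) =
        (fun n => complex.Re (q (s (n + K)%N) x) + complex.Re (- q k x)).
      by apply/funext => n; rewrite ReD.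
    rewrite ReD; apply: cvgD; last exact: cvg_cst.
    by rewrite (cvg_shiftn K (fun n => complex.Re (q (s n) x))).
  - apply: almost_all01_mono biP _ => x _ h.
    have -> : (fun n => complex.Im (q (s (n + K)%N) x - q k x)) =
        (fun n => complex.Im (q (s (n + K)%N) x) + complex.Im (- q k x)).
      by apply/funext => n; rewrite ImD.
    rewrite ImD; apply: cvgD; last exact: cvg_cst.
    by rewrite (cvg_shiftn K (fun n => complex.Im (q (s n) x))).
  - by move=> n; apply: KP => //; apply: leq_trans (ks _); exact: leq_addl.
exists g.
  have [K /(_ K (leqnn K)) [LgK _]] := lim _ ltr01.
  have -> : g = (fun x => (g x - q K x) + q K x) by apply/funext => x; rewrite subrK.
  exact: L2D.
apply/cvgrPdist_le => e e0; have [K KP] := lim _ e0.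
near=> k; rewrite sub0r normrN ger0_norm ?L2sqr_ge0// L2sqrBC.
by apply: (KP k _).2; near: k; exists K.
Unshelve. all: by end_near. Qed.

End completeness.

(** * Riesz representation for functionals controlled by the norm of a derivative *)

Section Riesz.
Context (R : realType).
Notation mu := (@lebesgue_measure R).
Notation I := (@I01 R).

Let mI := @measurable_I01 R.
Hint Resolve mI : core.

Lemma L2dot_L1 (f g : R -> R[i]) : L2 f -> L2 g -> L1 (fun x => f x * (g x)^*).
Proof. by move=> Lf Lg; apply: L2_mul_L1 => //; exact: L2_conj. Qed.

Lemma L2sqr_lincomb (c : R[i]) (f g : R -> R[i]) : L2 f -> L2 g ->
  L2sqr (fun x => c * f x + g x) =
  Normc.normc c ^+ 2 * L2sqr f + 2 * complex.Re (c * L2dot f g) + L2sqr g.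
Proof.
move=> Lf Lg; have L1fg := L2dot_L1 Lf Lg.
rewrite /L2dot -cintZ//; have /L1P[ifg _] := L1Z c L1fg.
case: Lf Lg => [mf f2] [mg g2].
rewrite /L2sqr /= -!RintegralZl// -!RintegralD//; last first.
- exact: (@integrable_scale _ _ (fun x => complex.Re (c * (f x * (g x)^*)))).
- exact: integrable_scale.
- apply: integrable_add; first exact: integrable_scale.
  exact: (@integrable_scale _ _ (fun x => complex.Re (c * (f x * (g x)^*)))).
congr Rintegral; apply/funext => x.
rewrite !normc_sqrE !ReD !ImD !Re_mulc !Im_mulc.
by case: c {ifg} => a b; case: (f x) (g x) => [u v] [w z] /=; ring.
Qed.

Lemma L2dot_self (f : R -> R[i]) : L2dot f f = (L2sqr f)%:C.
Proof.
rewrite /L2dot /L2sqr; apply: complex_eq => /=.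
  by congr Rintegral; apply/funext => x /=; rewrite normc_sqrE; case: (f x) => a b /=; ring.
rewrite -[RHS](Rintegral01_cst 0).
by congr Rintegral; apply/funext => x /=; case: (f x) => a b /=; ring.
Qed.

Lemma L2dot_le (f g : R -> R[i]) : L2 f -> L2 g ->
  Normc.normc (L2dot f g) ^+ 2 <= L2sqr f * L2sqr g.
Proof.
by move=> Lf Lg; rewrite -(L2sqr_conj g) normc_cint_mul_le//; exact: L2_conj.
Qed.

Lemma L2dotBr (f g h : R -> R[i]) : L2 f -> L2 g -> L2 h ->
  L2dot f (fun x => g x - h x) = L2dot f g - L2dot f h.
Proof.
move=> Lf Lg Lh; rewrite /L2dot -cintB; try exact: L2dot_L1.
by congr cint; apply/funext => x; rewrite raddfB mulrBr.
Qed.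

(* The representing element is the limit of D u_k along a minimising sequence
   u_k of J u = |D u|^2 - 2 Re (l u), which is Cauchy by the parallelogram law. *)
Lemma Riesz_representation (E : set (R -> R[i])) (D : (R -> R[i]) -> R -> R[i])
    (l : (R -> R[i]) -> R[i]) (C : R) :
  E !=set0 ->
  (forall c u v, E u -> E v -> E (fun x => c * u x + v x)) ->
  (forall u, E u -> L2 (D u)) ->
  (forall c u v, E u -> E v ->
    ae_eq01 (D (fun x => c * u x + v x)) (fun x => c * D u x + D v x)) ->
  (forall c u v, E u -> E v -> l (fun x => c * u x + v x) = c * l u + l v) ->
  (forall u, E u -> Normc.normc (l u) ^+ 2 <= C * L2sqr (D u)) ->
  exists h, [/\ L2 h, forall u, E u -> l u = L2dot (D u) h &
    exists u : nat -> R -> R[i], (forall k, E (u k)) /\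
      (fun k => L2sqr (fun x => D (u k) x - h x)) @ \oo --> (0 : R)].
Proof.
move=> [u0 Eu0] Elin DL Dlin llin lbd.
pose N u := L2sqr (D u).
pose J u := N u - 2 * complex.Re (l u).
have N0 u : 0 <= N u by exact: L2sqr_ge0.
have Jexp c u v : E u -> E v -> J (fun x => c * u x + v x) =
    J v + Normc.normc c ^+ 2 * N u + 2 * complex.Re (c * (L2dot (D u) (D v) - l u)).
  move=> Eu Ev; have Euv := Elin c u v Eu Ev.
  rewrite {1}/J {1}/N (L2sqr_ae _ _ (Dlin c u v Eu Ev)); last 2 first.
  - by case: (DL _ Euv).
  - by case: (L2D (L2Z c (DL _ Eu)) (DL _ Ev)).
  rewrite L2sqr_lincomb ?llin//; try exact: DL.
  by rewrite mulrBr !ReD ReN /J /N; ring.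
have Jlb u : E u -> - `|C| <= J u.
  move=> Eu; have h : Normc.normc (l u) ^+ 2 <= `|C| * N u.
    apply: le_trans (lbd u Eu) _.
    by apply: ler_wpM2r; [exact: N0|exact: ler_norm].
  have h1 := ler_norm (complex.Re (l u)).
  have h2 := norm_Re_le (l u).
  (* 2 |l u| <= 2 sqrt(|C| N u) <= |C| + N u, so [J] is bounded below. *)
  have h3 : Normc.normc (l u) *+ 2 <= `|C| + N u.
    rewrite -ler_sqr ?nnegrE ?addr_ge0// ?mulrn_wge0 ?normc_ge0//.
    by have := sqr_ge0 (`|C| - N u); nra.
  rewrite /J; lra.
have infJ : has_inf (J @` E).
  split; first by exists (J u0), u0.
  by exists (- `|C|) => _ [u Eu <-]; exact: Jlb.
pose m := inf (J @` E).
have Jm u : E u -> m <= J u by move=> Eu; apply: ge_inf; [exact: infJ.2|exists u].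
have /choice[u uP] : forall k, exists u, E u /\ J u <= m + k.+1%:R^-1.
  move=> k; have k0 : 0 < k.+1%:R^-1 :> R by rewrite invr_gt0 ltr0n.
  by have [_ [u Eu <-] /ltW h] := inf_adherent k0 infJ; exists u.
have Eu k : E (u k) by case: (uP k).
have uJ k : J (u k) <= m + k.+1%:R^-1 by case: (uP k).
(* The defect in the Euler equation of [J] at u_k in the direction w; it vanishes exactly when D u_k
   represents l at w. *)
pose z w k := L2dot (D w) (D (u k)) - l w.
have alg (Z n s d a b : R) : 0 <= Z -> 0 <= n -> 0 < s -> s * (n + 1) = 1 ->
    a <= b + d -> b <= a + s ^+ 2 * Z * n + 2 * (- s * Z) -> Z <= (n + 1) * d.
  move=> Z0 n0 s0 sn h1 h2.
  have h3 : Z * (2 * s - s ^+ 2 * n) <= d by lra.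
  have h5 : s <= 2 * s - s ^+ 2 * n by nra.
  rewrite -(ler_pM2l s0) mulrA sn mul1r mulrC.
  by apply: le_trans h3; rewrite ler_wpM2l.
(* Moving from u_k by - s (z w k)^* w cannot bring [J] below its infimum. The step s = 1 / (N w + 1)
   makes sense even if N w = 0 and satisfies s^2 N w <= s, which absorbs the quadratic term. *)
have zbound w k : E w -> Normc.normc (z w k) ^+ 2 <= (N w + 1) * k.+1%:R^-1.
  move=> Ew; pose s := (N w + 1)^-1.
  have N1 : 0 < N w + 1 by rewrite ltr_wpDl.
  have s0 : 0 < s by rewrite invr_gt0.
  have := Jm _ (Elin (- s%:C * (z w k)^*) _ _ Ew (Eu k)).
  rewrite Jexp// -/(z w k).
  have -> : Normc.normc (- s%:C * (z w k)^*) ^+ 2 = s ^+ 2 * Normc.normc (z w k) ^+ 2.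
    by rewrite !normc_sqrE; case: (z w k) => a b /=; ring.
  have -> : complex.Re (- s%:C * (z w k)^* * z w k) = - s * Normc.normc (z w k) ^+ 2.
    by rewrite normc_sqrE; case: (z w k) => a b /=; ring.
  have h4 : s * (N w + 1) = 1 by rewrite mulVf ?gt_eqF.
  exact: alg (sqr_ge0 _) (N0 w) s0 h4 (uJ k).
(* Here a is the infimum, jm the value of [J] at the midpoint, jj and jk those at u_j and u_k.
   Combining the expansions for c = 1 and c = 1/2 cancels the linear term r. *)
have parallelogram (a jj jk jm n r dj dk : R) : a <= jm -> jj = jk + n + 2 * r ->
    jm = jk + 2^-1 ^+ 2 * n + 2 * (2^-1 * r) -> jj <= a + dj -> jk <= a + dk ->
    n <= 2 * (dj + dk) by lra.
have d_cauchy j k : L2sqr (fun x => D (u j) x - D (u k) x) <= 2 * (j.+1%:R^-1 + k.+1%:R^-1).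
  pose d x := -1 * u k x + u j x.
  have Ed : E d by exact: Elin.
  have -> : L2sqr (fun x => D (u j) x - D (u k) x) = N d.
    apply: L2sqr_ae; [by case: (L2B (DL _ (Eu j)) (DL _ (Eu k)))|by case: (DL _ Ed)|].
    apply: ae_eq01_sym; apply: ae_eq01_trans (Dlin _ _ _ (Eu k) (Eu j)) _.
    by apply: almost_all01T => x _; rewrite mulN1r addrC.
  have h1 := Jexp 1 _ _ Ed (Eu k).
  rewrite (_ : (fun x => _) = u j) in h1; last first.
    by apply/funext => x; rewrite mul1r /d mulN1r addrAC addNr add0r.
  have h2 := Jexp (2^-1)%:C _ _ Ed (Eu k).
  have h3 := Jm _ (Elin (2^-1)%:C _ _ Ed (Eu k)).
  have e1 : Normc.normc (1 : R[i]) ^+ 2 = 1 by rewrite Normc.normc1 expr1n.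
  have e2 : Normc.normc (2^-1)%:C ^+ 2 = (2^-1) ^+ 2 :> R.
    by rewrite normc_sqrE /= expr0n /= addr0.
  rewrite e1 !mul1r in h1; rewrite e2 Re_mulc /= mul0r subr0 in h2.
  exact: parallelogram h3 h1 h2 (uJ j) (uJ k).
have cvgd : (fun k => k.+1%:R^-1) @ \oo --> (0 : R) by exact: cvg_harmonic.
have [h Lh cvh] : exists2 h, L2 h & (fun k => L2sqr (fun x => D (u k) x - h x)) @ \oo --> (0 : R).
  apply: L2_complete => [k|e e0]; first exact: DL.
  have e4 : 0 < e / 4 by rewrite divr_gt0.
  have /cvgrPdist_le /(_ _ e4) [K _ KP] := cvgd.
  exists K => j k Kj Kk; apply: le_trans (d_cauchy j k) _.
  have := KP j Kj; have := KP k Kk; rewrite /= !sub0r !normrN !ger0_norm ?invr_ge0//.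
  by move: (j.+1%:R^-1) (k.+1%:R^-1) => a b; lra.
exists h; split=> //; last by exists u.
move=> w Ew; apply/eqP; rewrite -subr_eq0; apply/eqP/Normc.eq0_normc/eqP.
rewrite -sqrf_eq0 eq_le sqr_ge0 andbT.
(* The error splits into the pairing of D w with D u_k - h and the defect [z w k]; both tend to
   0. *)
have bnd k : Normc.normc (l w - L2dot (D w) h) ^+ 2 <=
    2 * (N w * L2sqr (fun x => D (u k) x - h x)) + 2 * ((N w + 1) * k.+1%:R^-1).
  have LDk := DL _ (Eu k); have LDw := DL _ Ew.
  have -> : l w - L2dot (D w) h = L2dot (D w) (fun x => D (u k) x - h x) + - z w k.
    by rewrite L2dotBr// /z; ring.
  apply: le_trans (normcD_sqr_le _ _) _; rewrite normcN lerD// ler_wpM2l//.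
    by apply: L2dot_le => //; exact: L2B.
  exact: zbound.
have lim0 : (fun k => 2 * (N w * L2sqr (fun x => D (u k) x - h x)) +
    2 * ((N w + 1) * k.+1%:R^-1)) @ \oo --> (0 : R).
  have -> : (0 : R) = 2 * (N w * 0) + 2 * ((N w + 1) * 0) by ring.
  by apply: cvgD; apply: cvgMr; apply: cvgMr.
rewrite -(cvg_lim _ lim0)//; apply: limr_ge; first by apply/cvg_ex; exists 0.
exact: nearW.
Qed.

End Riesz.

(** * Smooth bump functions *)

Section smooth_functions.
Context (R : realType).
Implicit Types f g : R -> R.

(** Smoothness speaks of iterated derivatives of every order. A family stable under differentiation
    settles all orders at once, so the closure lemmas below need no Leibniz or chain formula of
    higher order. *)
Lemma smooth_of_closed_family (S : set (R -> R)) :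
  (forall f, S f -> exists2 f', S f' & forall x : R, is_derive x (1 : R) f (f' x)) ->
  forall f, S f -> smooth f.
Proof.
move=> SS f Sf n; suff [g Sg ->] : exists2 g, S g & derive1n n f = g.
  by have [g' _ dg] := SS _ Sg; move=> x; case: (dg x).
elim: n => [|n [g Sg gE]]; first by exists f.
have [g' Sg' dg] := SS _ Sg; exists g' => //; rewrite derive1nS gE.
by apply/funext => x; rewrite derive1E; case: (dg x).
Qed.

Lemma smooth_is_derive f (x : R) : smooth f -> is_derive x (1 : R) f (derive1 f x).
Proof. by move=> sf; rewrite derive1E; apply: derivableP; exact: (sf 0%N). Qed.

Lemma smooth_derive1 f : smooth f -> smooth (derive1 f).
Proof. by move=> sf n x; rewrite -derive1Sn; exact: sf. Qed.

Lemma smooth_continuous f : smooth f -> continuous f.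
Proof.
move=> sf x; apply: differentiable_continuous; apply/derivable1_diffP.
exact: (sf 0%N).
Qed.

Lemma smooth_of_derive f g : smooth g -> (forall x : R, is_derive x (1 : R) f (g x)) -> smooth f.
Proof.
move=> sg fg; have fE : derive1 f = g.
  by apply/funext => x; rewrite derive1E; case: (fg x).
by case=> [|n] x; [case: (fg x)|rewrite derive1Sn fE; exact: sg].
Qed.

Lemma smooth_cst (c : R) : smooth (fun _ : R => c).
Proof.
apply: (@smooth_of_closed_family [set f | exists c, f = fun=> c]); last by exists c.
by move=> _ [d ->]; exists (fun=> 0); [exists 0|move=> x; exact: is_derive_cst].
Qed.

Lemma smoothD f g : smooth f -> smooth g -> smooth (fun x => f x + g x).
Proof.
move=> sf sg; apply: (@smooth_of_closed_family
  [set h | exists f g, [/\ smooth f, smooth g & h = (fun x => f x + g x)]]); last by exists f, g.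
move=> _ [{sf sg}f [{}g [sf sg ->]]].
exists (fun x => derive1 f x + derive1 g x).
  by exists (derive1 f), (derive1 g); split; [exact: smooth_derive1|exact: smooth_derive1|].
by move=> x; apply: is_deriveD; exact: smooth_is_derive.
Qed.

(** Products alone are not stable under differentiation, because the product rule creates sums; sums
    of products are. *)
Inductive smooth_span : (R -> R) -> Prop :=
| smooth_span_mul f g : smooth f -> smooth g -> smooth_span (fun x => f x * g x)
| smooth_span_add f g : smooth_span f -> smooth_span g -> smooth_span (fun x => f x + g x).

Lemma smoothM f g : smooth f -> smooth g -> smooth (fun x => f x * g x).
Proof.
move=> sf sg; apply: (@smooth_of_closed_family smooth_span); last exact: smooth_span_mul.
move=> h; elim=> {sf sg}{}f {}g.
  move=> sf sg; exists (fun x => f x * derive1 g x + g x * derive1 f x).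
    by apply: smooth_span_add; [exact: smooth_span_mul sf (smooth_derive1 sg)|
      exact: smooth_span_mul sg (smooth_derive1 sf)].
  by move=> x; apply: is_deriveM; exact: smooth_is_derive.
move=> _ [f' Sf' df] _ [g' Sg' dg]; exists (fun x => f' x + g' x).
  exact: smooth_span_add.
by move=> x; apply: is_deriveD.
Qed.

Lemma smoothN f : smooth f -> smooth (fun x => - f x).
Proof.
move=> sf; have := smoothM (@smooth_cst (-1)) sf.
by rewrite (_ : (fun _ => _) = fun x => - f x)//; apply/funext => x; rewrite mulN1r.
Qed.

Lemma smoothB f g : smooth f -> smooth g -> smooth (fun x => f x - g x).
Proof. by move=> sf sg; apply: smoothD; [exact: sf|exact: smoothN]. Qed.

Lemma smoothX f n : smooth f -> smooth (fun x => f x ^+ n).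
Proof.
move=> sf; elim: n => [|n ih].
  by rewrite (_ : (fun _ => _) = fun=> 1); [exact: smooth_cst|apply/funext => x; rewrite expr0].
rewrite (_ : (fun _ => _) = fun x => f x * f x ^+ n); first exact: smoothM.
by apply/funext => x; rewrite exprS.
Qed.

Lemma smooth_comp_affine f (c d : R) : smooth f -> smooth (fun x => f (c * x + d)).
Proof.
(* The scalar k collects the factors c that the chain rule produces. *)
move=> sf; apply: (@smooth_of_closed_family
  [set h | exists (k : R) f, smooth f /\ h = (fun x => k * f (c * x + d))]); last first.
  by exists 1, f; split=> //; apply/funext => x; rewrite mul1r.
move=> _ [k [{sf}f [sf ->]]].
exists (fun x => k * c * derive1 f (c * x + d)).
  by exists (k * c), (derive1 f); split; [exact: smooth_derive1|].
move=> x.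
have h : is_derive x (1 : R) (f \o (fun x => c * x + d)) (derive1 f (c * x + d) * c).
  apply: is_derive1_comp; first exact: smooth_is_derive.
  have := is_deriveD (is_deriveZ c (is_derive_id x (1 : R))) (is_derive_cst d x (1 : R)).
  by rewrite addr0 /GRing.scale/= mulr1.
have := is_deriveZ k h; rewrite /GRing.scale/= => {}h.
by apply: is_derive_eq h _; ring.
Qed.

(* P(1/x) exp(-1/x) on the positive half-line: the class of these functions, for
   P a polynomial, is closed under differentiation. *)
Definition flat (P : {poly R}) (x : R) : R :=
  if 0 < x then P.[x^-1] * expR (- x^-1) else 0.

(** From exp(y) >= y^(i+1) / (i+1)! with y = 1/x, each x^-i exp(-1/x) is at most (i+1)! x. A linear
    bound suffices, because the factor 1/h of a difference quotient at 0 can be moved into P. *)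
Lemma flat_bound (P : {poly R}) : exists C : R, forall x, `|flat P x| <= C * `|x|.
Proof.
pose C : R := \sum_(i < size P) `|P`_i| * (i.+1)`!%:R.
exists C => x; have C0 : 0 <= C by apply: sumr_ge0 => i _; rewrite mulr_ge0.
rewrite /flat; case: ifPn => [x0|_]; last by rewrite normr0 mulr_ge0.
rewrite (gtr0_norm x0) horner_coef mulr_suml /C mulr_suml.
apply: le_trans (ler_norm_sum _ _ _) _; apply: ler_sum => i _.
rewrite !normrM -!mulrA ler_wpM2l//.
have y0 : 0 <= x^-1 by rewrite invr_ge0 ltW.
rewrite !ger0_norm ?expR_ge0 ?exprn_ge0// expRN.
have f0 : 0 < (i.+1)`!%:R :> R by rewrite ltr0n fact_gt0.
rewrite ler_pdivrMr ?expR_gt0//.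
have h := expR_ge1Dxn i y0.
apply: (@le_trans _ _ ((i.+1)`!%:R * x * (x^-1 ^+ i.+1 / (i.+1)`!%:R))); last first.
  rewrite ler_wpM2l ?mulr_ge0// ?(ltW x0)//.
  by apply: le_trans h; rewrite lerDr.
rewrite exprS le_eqVlt; apply/orP; left; apply/eqP; field.
by rewrite !gt_eqF.
Qed.

(** For x > 0 the derivative of P(1/x) exp(-1/x) is x^-2 (P - P')(1/x) exp(-1/x), whence the
    polynomial. *)
Lemma is_derive_flat (P : {poly R}) (x : R) :
  is_derive x (1 : R) (flat P) (flat ('X ^+ 2 * (P - P^`())) x).
Proof.
have [x0|x0|->] := ltrgt0P x.
- apply: (@near_eq_is_derive _ R R (fun y : R => P.[y^-1] * expR (- y^-1))).
  + near=> y; rewrite /flat ifT//; near: y; exact: lt_nbhsr.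
  + rewrite /flat x0.
    have dV : is_derive x (1 : R) (fun y : R => y^-1) (- x ^- 2).
      have := is_deriveV _ (is_derive_id x (1 : R)); rewrite /GRing.scale/= mulr1; apply.
      by rewrite gt_eqF.
    have dP := is_derive1_comp (is_derive_poly P x^-1) dV.
    have dN : is_derive x (1 : R) (fun y : R => - y^-1) (x ^- 2).
      by apply: is_derive_eq (is_deriveN dV) _; rewrite opprK.
    have dE := @is_derive1_comp R expR (fun y : R => - y^-1) x _ _
      (is_derive_expR (- x^-1)) dN.
    apply: is_derive_eq (is_deriveM dP dE) _.
    rewrite /GRing.scale/= hornerM hornerXn hornerD hornerN.
    by move: (expR _) P.[_] P^`().[_] => a b c; field; rewrite gt_eqF.
- apply: (@near_eq_is_derive _ R R (cst 0)).
  + near=> y; rewrite /flat ifN// -leNgt ltW//; near: y; exact: lt_nbhsl.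
  + by rewrite /flat ifN -?leNgt ?ltW//; exact: is_derive_cst.
(* At 0 the difference quotient for the increment h is [flat ('X * P) h], which is O(h). *)
- rewrite {2}/flat ltxx.
  have [C CP] := flat_bound ('X * P).
  have h : (fun h : R => h^-1 *: (flat P (h *: 1 + 0) - flat P 0)) @ (0 : R)^' --> (0 : R).
    have C1 : 0 < `|C| + 1 by rewrite ltr_wpDl.
    apply/cvgrPdist_le => e e0; rewrite near_withinE.
    have d0 : 0 < (`|C| + 1)^-1 * e by rewrite mulr_gt0// invr_gt0.
    apply: filterS (nbhs0_le d0) => h hd _.
    rewrite sub0r normrN addr0 /GRing.scale/= mulr1 {2}/flat ltxx subr0.
    have -> : h^-1 * flat P h = flat ('X * P) h.
      by rewrite /flat; case: ifP; rewrite ?mulr0// hornerM hornerX mulrA.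
    apply: le_trans (CP h) _.
    apply: (@le_trans _ _ ((`|C| + 1) * `|h|)).
      by rewrite ler_wpM2r// (le_trans (ler_norm C))// lerDl.
    by rewrite -ler_pdivlMl.
  apply: DeriveDef; first by apply/cvg_ex; exists 0.
  by apply: cvg_lim.
Unshelve. all: by end_near. Qed.

Lemma smooth_flat P : smooth (flat P).
Proof.
apply: (@smooth_of_closed_family [set f | exists P, f = flat P]); last by exists P.
move=> _ [Q ->]; exists (flat ('X ^+ 2 * (Q - Q^`()))); first by eexists.
exact: is_derive_flat.
Qed.

Lemma flat1E (x : R) : flat 1 x = if 0 < x then expR (- x^-1) else 0.
Proof. by rewrite /flat hornerC mul1r. Qed.

Definition bumpfun (a b x : R) : R := flat 1 (x - a) * flat 1 (b - x).

Lemma smooth_bumpfun a b : smooth (bumpfun a b).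
Proof.
apply: smoothM.
  have := @smooth_comp_affine _ 1 (- a) (@smooth_flat 1).
  by rewrite (_ : (fun _ => _) = fun x => flat 1 (x - a))//; apply/funext => x; rewrite mul1r.
have := @smooth_comp_affine _ (-1) b (@smooth_flat 1).
rewrite (_ : (fun _ => _) = fun x => flat 1 (b - x))//.
by apply/funext => x; rewrite mulN1r addrC.
Qed.

Lemma flat1_ge0_lt1 (x : R) : 0 <= flat 1 x < 1.
Proof.
rewrite flat1E; case: ifP => x0; last by rewrite lexx ltr01.
by rewrite expR_ge0 expR_lt1 oppr_lt0 invr_gt0 x0.
Qed.

Lemma flat1_gt0 (x : R) : (0 < flat 1 x) = (0 < x).
Proof. by rewrite flat1E; case: ifP => x0; rewrite ?expR_gt0 ?ltxx. Qed.

Lemma bumpfun_ge0_lt1 a b x : 0 <= bumpfun a b x < 1.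
Proof.
have /andP[u0 u1] := flat1_ge0_lt1 (x - a); have /andP[v0 v1] := flat1_ge0_lt1 (b - x).
by rewrite /bumpfun mulr_ge0//=; nra.
Qed.

Lemma bumpfun_gt0 a b x : a < x < b -> 0 < bumpfun a b x.
Proof. by case/andP => ax xb; rewrite /bumpfun mulr_gt0// flat1_gt0 subr_gt0. Qed.

Lemma bumpfun_eq0 a b x : ~~ (a < x < b) -> bumpfun a b x = 0.
Proof.
have h y : ~~ (0 < y) -> flat 1 y = 0 by rewrite flat1E => /negbTE ->.
rewrite /bumpfun negb_and => /orP[ax|xb].
  by rewrite h ?mul0r// subr_gt0.
by rewrite [X in _ * X]h ?mulr0// subr_gt0.
Qed.

End smooth_functions.

(** * The lemmas of Lagrange and du Bois-Reymond *)

Section fundamental_lemma.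
Context (R : realType).
Notation mu := (@lebesgue_measure R).
Notation I := (@I01 R).
Implicit Types (f g v w psi : R -> R).

Let mI := @measurable_I01 R.
Hint Resolve mI : core.

(** Compact supports are replaced by intervals [a, b], which are easy to join and to integrate
    over. *)
Definition real_test psi := smooth psi /\
  exists a b : R, [/\ 0 < a, b < 1 & forall x, ~~ (a <= x <= b) -> psi x = 0].

Lemma I01E x : I x = (0 < x < 1) :> Prop.
Proof. by rewrite /I01 /= in_itv. Qed.

Lemma continuous_bounded01 f : continuous f -> exists M, forall x, 0 <= x <= 1 -> `|f x| <= M.
Proof.
move=> cf; have cnf : {within `[0, 1], continuous (fun x => `|f x|)}.
  apply: continuous_subspaceT => x.
  by apply: continuous_comp; [exact: cf|exact: norm_continuous].
have [c _ cP] := EVT_max (@ler01 R) cnf.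
by exists `|f c| => x x01; apply: cP; rewrite in_itv.
Qed.

Lemma integrable_mul_continuous v f : mu.-integrable I (EFin \o v) -> continuous f ->
  mu.-integrable I (EFin \o (fun x => v x * f x)).
Proof.
move=> iv cf; have [M MP] := continuous_bounded01 cf.
apply: (@integrable_bound _ _ (fun x => M * `|v x|)).
- apply: measurable_funM; first exact: integrable_measurable.
  by apply: measurable_funTS; exact: continuous_measurable_fun.
- by apply: integrable_scale; exact: integrable_norm.
- move=> x; rewrite I01E => /andP[x0 x1]; rewrite normrM mulrC.
  by apply: ler_wpM2r => //; apply: MP; rewrite !ltW.
Qed.

(* The functions 1 - (1 - bumpfun a b)^k increase to the indicator of ]a, b[. *)
Lemma Rintegral_itv_eq0_of_test v : mu.-integrable I (EFin \o v) ->
  (forall psi, real_test psi -> Rintegral mu I (fun x => v x * psi x) = 0) ->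
  forall a b : R, 0 < a -> a < b -> b < 1 -> Rintegral mu `]a, b[ v = 0.
Proof.
move=> iv h a b a0 ab b1.
pose app k x := 1 - (1 - bumpfun a b x) ^+ k.
have app_test k : real_test (app k).
  split.
    apply: smoothB; first exact: smooth_cst.
    by apply: smoothX; apply: smoothB; [exact: smooth_cst|exact: smooth_bumpfun].
  exists a, b; split=> // x; rewrite /app => abx.
  rewrite bumpfun_eq0 ?subr0 ?expr1n ?subrr//.
  by apply: contra abx => /andP[ax xb]; rewrite !ltW.
have app01 k x : 0 <= app k x <= 1.
  have /andP[u0 u1] := bumpfun_ge0_lt1 a b x.
  rewrite /app subr_ge0 exprn_ile1 ?subr_ge0 ?(ltW u1) ?gerBl//=.
  by rewrite exprn_ge0// subr_ge0 ltW.
have mv : measurable_fun I v by exact: integrable_measurable.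
pose lim := v \_ `]a, b[.
have abI : `]a, b[ `<=` I.
  by move=> x; rewrite I01E /= in_itv/= => /andP[ax xb]; rewrite (lt_trans a0)// (lt_trans xb).
have := @dominated_convergence _ _ _ mu I mI (fun k x => (v x * app k x)%:E)
  (fun x => (lim x)%:E) (fun x => `|v x|%:E).
case.
- move=> k; apply/measurable_EFinP; apply: integrable_measurable.
  by apply: integrable_mul_continuous => //; apply: smooth_continuous; case: (app_test k).
- apply/measurable_EFinP; apply/measurable_restrict => //.
  exact: (measurable_funS mI (@subIsetl _ _ _) mv).
- apply: aeW => x Ix; apply: cvg_EFin; first exact: nearW.
  rewrite /comp/=.
  have -> : lim x = v x * (x \in `]a, b[)%:R.
    rewrite /lim patchE mem_setE; case: (x \in _); rewrite ?mulr1 ?mulr0//.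
  apply: cvgMr; rewrite in_itv/=; case: (boolP (a < x < b)) => abx /=.
    rewrite -[X in _ --> X]subr0; apply: cvgB; first exact: cvg_cst.
    apply: cvg_expr; have /andP[u0 u1] := bumpfun_ge0_lt1 a b x.
    by rewrite ger0_norm ?subr_ge0 ?(ltW u1)// ltrBlDr ltrDl bumpfun_gt0.
  rewrite (_ : (fun k => _) = cst 0); first exact: cvg_cst.
  by apply/funext => k; rewrite /app bumpfun_eq0// subr0 expr1n subrr.
- exact: integrable_norm.
- apply: aeW => x k Ix; rewrite lee_fin normrM ler_piMr//.
  by have /andP[p0 p1] := app01 k x; rewrite ger0_norm.
move=> ilim _ /=.
have -> : (fun n => \int[mu]_(x in I) (v x * app n x)%:E)%E = cst 0%E.
  apply/funext => n /=; have := h _ (app_test n); rewrite /Rintegral => e.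
  rewrite -[LHS]fineK ?e//; apply: integrable_fin_num => //.
  by apply: integrable_mul_continuous => //; apply: smooth_continuous; case: (app_test n).
move=> /cvg_lim; rewrite lim_cst// => /(_ (@ereal_hausdorff R)) e.
rewrite -[LHS](_ : Rintegral mu I lim = _); last first.
  by rewrite /lim -Rintegral_mkcondr setIidr.
by rewrite /Rintegral -e.
Qed.

(** The integrals of v over inner intervals vanish, so its primitive is constant on (0,1); by
    Lebesgue differentiation v is almost everywhere the derivative of that primitive. *)
Lemma fundamental_lemma v : mu.-integrable I (EFin \o v) ->
  (forall psi, real_test psi -> Rintegral mu I (fun x => v x * psi x) = 0) ->
  almost_all01 (fun x => v x = 0).
Proof.
move=> iv h; have itv0 := Rintegral_itv_eq0_of_test iv h.
(* Extended by zero, since the primitive is taken from -oo. *)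
pose w := v \_ I.
have iw : mu.-integrable setT (EFin \o w).
  rewrite -restrict_EFin; exact: (integrable_mkcond _ mI).1.
pose F x := Rintegral mu `]-oo, x] w.
have dF : {ae mu, forall x, derivable F x 1 /\ derive1 F x = w x}.
  apply: FTC1Ny; first by move=> y; apply: integrableS iw.
  exact: integrable_locally.
have Fcst x y : 0 < x -> x < y -> y < 1 -> F x = F y.
  move=> x0 xy y1; apply/eqP; rewrite eq_sym -subr_eq0; apply/eqP.
  have iwy : mu.-integrable `]-oo, y] (EFin \o w) by apply: integrableS iw.
  have ixy : mu.-integrable `]x, y[ (EFin \o w) by apply: integrableS iw.
  rewrite /F (@Rintegral_itvB _ w -oo%O (BRight y) x iwy)//; last by rewrite bnd_simp ltW.
  rewrite -Rintegral_itv_bndo_bndc// -(itv0 x y x0 xy y1).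
  apply: eq_Rintegral => z; rewrite inE /= in_itv/= => /andP[xz zy].
  by rewrite /w patchE mem_set// I01E (lt_trans x0 xz) (lt_trans zy y1).
apply: (@filterS _ _ (ae_filter_ringOfSetsType mu) _ _ _ dF) => x [_ dFx] Ix.
move: (Ix); rewrite I01E => /andP[x0 x1].
have -> : v x = w x by rewrite /w patchE mem_set.
rewrite -dFx derive1E.
rewrite (@near_eq_derive _ _ _ F (cst (F x)) x); first exact: derive_cst.
near=> y.
have y0 : 0 < y by near: y; exact: lt_nbhsr.
have y1 : y < 1 by near: y; exact: lt_nbhsl.
by have [xy|yx|->//] := ltgtP x y; [rewrite (Fcst x y)|rewrite (Fcst y x)].
Unshelve. all: by end_near. Qed.

Lemma real_test_integrable psi (A : set R) : real_test psi ->
  measurable (A : set (measurableTypeR R)) -> mu.-integrable A (EFin \o psi).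
Proof.
move=> [spsi [a [b [a0 b1 psi0]]]] mA.
apply: (@integrableS _ _ _ mu setT) => //.
have -> : EFin \o psi = (EFin \o psi) \_ `[a, b].
  apply/funext => x; rewrite patchE mem_setE in_itv/=.
  by case: ifPn => // /psi0 /= ->.
apply: (integrable_mkcond _ _).1; first exact: measurable_itv.
apply: continuous_compact_integrable; first exact: segment_compact.
by apply: continuous_subspaceT; exact: smooth_continuous.
Qed.

Lemma real_testD f g : real_test f -> real_test g -> real_test (fun x => f x + g x).
Proof.
move=> [sf [a [b [a0 b1 f0]]]] [sg [c [d [c0 d1 g0]]]].
split; first exact: smoothD.
exists (Num.min a c), (Num.max b d); split; rewrite ?lt_min ?gt_max ?a0 ?b1//.
move=> x; rewrite negb_and -!ltNge lt_min gt_max => h.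
have [ha hc] : ~~ (a <= x <= b) /\ ~~ (c <= x <= d).
  by rewrite !negb_and -!ltNge; case/orP: h => /andP[-> ->]; rewrite ?orbT.
by rewrite f0// g0// addr0.
Qed.

Lemma real_testZ (c : R) f : real_test f -> real_test (fun x => c * f x).
Proof.
move=> [sf [a [b [a0 b1 f0]]]].
split; first exact: (smoothM (@smooth_cst _ c) sf).
by exists a, b; split=> // x /f0 ->; rewrite mulr0.
Qed.

Lemma real_test_derive1 psi : real_test psi -> real_test (derive1 psi).
Proof.
move=> [spsi [a [b [a0 b1 psi0]]]]; split; first exact: smooth_derive1.
exists a, b; split=> // x nx; rewrite derive1E.
rewrite (@near_eq_derive _ _ _ psi (cst 0)) ?derive_cst//.
move: nx; rewrite negb_and -!ltNge => /orP[xa|bx].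
  near=> y; rewrite psi0// negb_and -!ltNge; apply/orP; left.
  by near: y; exact: lt_nbhsl.
near=> y; rewrite psi0// negb_and -!ltNge; apply/orP; right.
by near: y; exact: lt_nbhsr.
Unshelve. all: by end_near. Qed.

(** Mean zero is what makes the primitive from -oo vanish again to the right of the support, so that
    it is a test function itself. *)
Lemma real_test_primitive psi : real_test psi -> Rintegral mu I psi = 0 ->
  exists2 phi, real_test phi & derive1 phi = psi.
Proof.
move=> tpsi ipsi; have [spsi [a [b [a0 b1 psi0]]]] := tpsi.
pose phi x := Rintegral mu `]-oo, x] psi.
have dphi x : derivable phi x 1 /\ derive1 phi x = psi x.
  apply: (@continuous_FTC1 _ psi -oo%O x (x + 1)).
  - by rewrite ltrDl.
  - by apply: real_test_integrable => //; exact: measurable_itv.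
  - by rewrite ltNyr.
  - exact: smooth_continuous.
exists phi; last by apply/funext => x; case: (dphi x).
split.
  apply: (smooth_of_derive spsi) => x; case: (dphi x) => d1 d2.
  exact: DeriveDef d1 (etrans (esym (derive1E _ _)) d2).
exists a, b; split=> // x; rewrite negb_and -!ltNge => /orP[xa|bx].
  transitivity (Rintegral mu `]-oo, x] (cst 0)).
    apply: eq_Rintegral => y; rewrite inE/= in_itv/= => yx; apply: psi0.
    by rewrite negb_and -!ltNge (le_lt_trans yx xa).
  by rewrite Rintegral_cst ?mul0r//; exact: measurable_itv.
rewrite -ipsi /phi Rintegral_mkcond [RHS]Rintegral_mkcond; congr Rintegral.
apply/funext => y; rewrite !patchE !mem_setE !in_itv/=.
have [/andP[ay yb]|/psi0 ->] := boolP (a <= y <= b); last by rewrite !if_same.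
by rewrite (le_trans yb (ltW bx)) (lt_le_trans a0 ay) (le_lt_trans yb b1).
Qed.

Lemma Rintegral_derive_smooth psi (c : R) : smooth psi -> 0 < c ->
  Rintegral mu `[0, c] (derive1 psi) = psi c - psi 0.
Proof.
move=> spsi c0; rewrite /Rintegral (@continuous_FTC2 _ _ psi 0 c)//.
- by apply: continuous_subspaceT; apply: smooth_continuous; exact: smooth_derive1.
- have cpsi := smooth_continuous spsi.
  split; first by move=> x _; exact: (spsi 0%N).
    by apply: cvg_at_right_filter; exact: cpsi.
  by apply: cvg_at_left_filter; exact: cpsi.
Qed.

Lemma Rintegral_I01_itvcc f : mu.-integrable `[0, 1] (EFin \o f) ->
  Rintegral mu I f = Rintegral mu `[0, 1] f.
Proof.
move=> fi; rewrite /I01 Rintegral_itv_obnd_cbnd ?Rintegral_itv_bndo_bndc//.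
  by apply: integrableS fi; [exact: measurable_itv|exact: measurable_itv|exact: subset_itv_co_cc].
by apply: integrableS fi; [exact: measurable_itv|exact: measurable_itv|exact: subset_itv_oo_cc].
Qed.

Lemma Rintegral_derive_real_test psi : real_test psi -> Rintegral mu I (derive1 psi) = 0.
Proof.
move=> tpsi; have [spsi [a [b [a0 b1 psi0]]]] := tpsi.
rewrite Rintegral_I01_itvcc; last first.
  by apply: real_test_integrable; [exact: real_test_derive1|exact: measurable_itv].
rewrite Rintegral_derive_smooth// !psi0 ?subrr// negb_and -!ltNge.
  by rewrite a0.
by rewrite b1 orbT.
Qed.

(** The value at x is the integral of the derivative from 0, where psi vanishes; this is the
    pointwise form of the Poincare inequality. *)
Lemma real_test_sup_bound psi x : real_test psi -> 0 < x < 1 ->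
  `|psi x| <= Rintegral mu I (fun y => `|derive1 psi y|).
Proof.
move=> tpsi /andP[x0 x1]; have [spsi [a [b [a0 b1 psi0]]]] := tpsi.
have -> : psi x = Rintegral mu `[0, x] (derive1 psi).
  by rewrite Rintegral_derive_smooth// (psi0 0) ?subr0// negb_and -!ltNge a0.
have id (A : set R) : measurable (A : set (measurableTypeR R)) ->
    mu.-integrable A (EFin \o (fun y => `|derive1 psi y|)).
  by move=> mA; apply: integrable_norm; apply: real_test_integrable (real_test_derive1 tpsi) mA.
apply: le_trans (le_normr_Rintegral _ _) _.
- exact: measurable_itv.
- by apply: real_test_integrable; [exact: real_test_derive1|exact: measurable_itv].
rewrite Rintegral_I01_itvcc; last by apply: id; exact: measurable_itv.
rewrite /Rintegral fine_le//.
- by apply: integrable_fin_num; [exact: measurable_itv|apply: id; exact: measurable_itv].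
- by apply: integrable_fin_num; [exact: measurable_itv|apply: id; exact: measurable_itv].
apply: ge0_subset_integral; try exact: measurable_itv.
- by apply: measurable_int; apply: id; exact: measurable_itv.
- by move=> y _; rewrite lee_fin.
- by apply: subset_itvl; rewrite bnd_simp ltW.
Qed.

(** Were every test function of mean zero, the fundamental lemma for the constant 1 would give 1 = 0
    almost everywhere; no bump has to be integrated. *)
Lemma real_test_mean1 : exists2 rho, real_test rho & Rintegral mu I rho = 1.
Proof.
have [[psi tpsi ipsi]|nex] := pselect (exists2 psi, real_test psi & Rintegral mu I psi != 0).
  exists (fun x => (Rintegral mu I psi)^-1 * psi x); first exact: real_testZ.
  by rewrite RintegralZl ?mulVf//; exact: real_test_integrable.
exfalso.
have one0 : almost_all01 (fun _ : R => 1 = 0 :> R).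
  apply: (@fundamental_lemma (cst 1)); first exact: integrable_const.
  move=> psi tpsi; apply/eqP; apply: contraPT isT => h; case: nex; exists psi => //.
  by move: h; congr (_ != _); congr Rintegral; apply/funext => x; rewrite mul1r.
have := Rintegral_ae (@measurable_cst _ _ _ _ _ _) (@measurable_cst _ _ _ _ _ _) one0.
by rewrite !Rintegral01_cst => /eqP; rewrite oner_eq0.
Qed.

(** The constant is int w rho for a test function rho of mean 1: for any psi, the function psi -
    (int psi) rho has mean zero, hence is the derivative of a test function and is annihilated by
    w. *)
Lemma du_Bois_Reymond_real w : mu.-integrable I (EFin \o w) ->
  (forall psi, real_test psi -> Rintegral mu I (fun x => w x * derive1 psi x) = 0) ->
  exists c, almost_all01 (fun x => w x = c).
Proof.
move=> iw h; have [rho trho irho] := real_test_mean1.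
have crho := smooth_continuous (proj1 trho).
have iwrho := integrable_mul_continuous iw crho.
pose c := Rintegral mu I (fun x => w x * rho x); exists c.
suff : almost_all01 (fun x => w x - c = 0).
  by move=> k; apply: almost_all01_mono k _ => x _ /eqP; rewrite subr_eq0 => /eqP.
apply: fundamental_lemma.
  by apply: integrable_add => //; exact: integrable_const.
move=> psi tpsi; pose m := Rintegral mu I psi.
have ipsi : mu.-integrable I (EFin \o psi) by exact: real_test_integrable.
have irho' : mu.-integrable I (EFin \o rho) by exact: real_test_integrable.
have iwpsi := integrable_mul_continuous iw (smooth_continuous (proj1 tpsi)).
have t0 : real_test (fun x => psi x + (- m) * rho x).
  by apply: real_testD => //; exact: real_testZ.
have i0 : Rintegral mu I (fun x => psi x + (- m) * rho x) = 0.
  by rewrite RintegralD ?RintegralZl ?irho ?mulr1 ?subrr//; exact: integrable_scale.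
have [phi tphi phiE] := real_test_primitive t0 i0.
have := h _ tphi; rewrite phiE.
have -> : (fun x => w x * (psi x + - m * rho x)) =
    (fun x => w x * psi x + (- m) * (w x * rho x)) by apply/funext => x; ring.
rewrite RintegralD ?RintegralZl//; last exact: integrable_scale.
have -> : (fun x => (w x - c) * psi x) = (fun x => w x * psi x + (- c) * psi x).
  by apply/funext => x; ring.
rewrite RintegralD ?RintegralZl//; last exact: integrable_scale.
by rewrite -/c -/m mulNr (mulrC m c) mulNr.
Qed.

End fundamental_lemma.

(** * Complex test functions: calculus, Poincare inequality and the two lemmas for complex
    integrands *)

Section test_functions.
Context (R : realType).
Notation mu := (@lebesgue_measure R).
Notation I := (@I01 R).
Notation cRe := (@complex.Re R).
Notation cIm := (@complex.Im R).
Implicit Types (f g u v w phi psi : R -> R[i]).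

Let mI := @measurable_I01 R.
Hint Resolve mI : core.

Lemma compact_I01_sub_itv (K : set R) : compact K -> K `<=` I ->
  exists a b : R, [/\ 0 < a, b < 1 & forall x, K x -> a <= x <= b].
Proof.
move=> cK KI; have [->|K0] := eqVneq K set0.
  by exists 2^-1, 2^-1; split=> //; lra.
move/set0P: K0 => K0.
have cid : {within K, continuous (@id R)} by apply: continuous_subspaceT => x; exact: cvg_id.
have [b Kb bP] := compact_EVT_max K0 cK cid.
have [a Ka aP] := compact_EVT_min K0 cK cid.
exists a, b; split.
- by have := KI a (set_mem Ka); rewrite I01E => /andP[].
- by have := KI b (set_mem Kb); rewrite I01E => /andP[].
- by move=> x Kx; rewrite aP ?bP//; exact: mem_set.
Qed.

Lemma test_functionP phi : test_function phi <->
  real_test (cRe \o phi) /\ real_test (cIm \o phi).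
Proof.
split=> [[sr si [K [cK KI K0]]]|[[sr [a [b [a0 b1 r0]]]] [si [c [d [c0 d1 i0]]]]]].
  have [a [b [a0 b1 Kab]]] := compact_I01_sub_itv cK KI.
  have phi0 x : ~~ (a <= x <= b) -> phi x = 0.
    by move=> nx; apply: K0 => /Kab; exact/negP.
  by split; split; [exact: sr| |exact: si|]; exists a, b; split=> // x /phi0 /= ->.
split; [exact: sr|exact: si|exists `[Num.min a c, Num.max b d]%classic; split].
- exact: segment_compact.
- move=> x; rewrite /= in_itv/= ge_min le_max I01E => /andP[h1 h2].
  by apply/andP; split; [case/orP: h1; apply: lt_le_trans|case/orP: h2 => /le_lt_trans; apply].
- move=> x /negP; rewrite /= in_itv/= negb_and -!ltNge lt_min gt_max => h.
  have [ha hc] : ~~ (a <= x <= b) /\ ~~ (c <= x <= d).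
    by rewrite !negb_and -!ltNge; case/orP: h => /andP[-> ->]; rewrite ?orbT.
  by apply: complex_eq; [exact: r0|exact: i0].
Qed.

Lemma real_test_mul (f g : R -> R) : real_test f -> smooth g -> real_test (fun x => f x * g x).
Proof.
move=> [sf [a [b [a0 b1 f0]]]] sg; split; first exact: smoothM.
by exists a, b; split=> // x /f0 ->; rewrite mul0r.
Qed.

Lemma test_function_lincomb (c : R[i]) phi psi : test_function phi -> test_function psi ->
  test_function (fun x => c * phi x + psi x).
Proof.
move=> /test_functionP[r1 i1] /test_functionP[r2 i2]; apply/test_functionP; split.
  rewrite (_ : _ \o _ = fun x => (cRe c * cRe (phi x) + (- cIm c) * cIm (phi x)) + cRe (psi x)).
    apply: real_testD r2; apply: real_testD; [exact: real_testZ r1|exact: real_testZ i1].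
  by apply/funext => x /=; rewrite ReD Re_mulc mulNr.
rewrite (_ : _ \o _ = fun x => (cRe c * cIm (phi x) + cIm c * cRe (phi x)) + cIm (psi x)).
  apply: real_testD i2; apply: real_testD; [exact: real_testZ i1|exact: real_testZ r1].
by apply/funext => x /=; rewrite ImD Im_mulc.
Qed.

Lemma test_function_real (psi : R -> R) : real_test psi -> test_function (fun x => (psi x)%:C).
Proof.
move=> tpsi; apply/test_functionP; split; first exact: tpsi.
split; first exact: smooth_cst.
by exists 2^-1, 2^-1; split=> //; lra.
Qed.

Lemma test_function0 : test_function (fun=> 0 : R[i]).
Proof.
apply: (@test_function_real (fun=> 0)); split; first exact: smooth_cst.
by exists 2^-1, 2^-1; split=> //; lra.
Qed.

Lemma test_function_cderive phi : test_function phi -> test_function (cderive phi).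
Proof.
by move=> /test_functionP[r1 i1]; apply/test_functionP; split;
  [exact: real_test_derive1 r1|exact: real_test_derive1 i1].
Qed.

Lemma cderive_lincomb (c : R[i]) phi psi : test_function phi -> test_function psi ->
  cderive (fun x => c * phi x + psi x) = fun x => c * cderive phi x + cderive psi x.
Proof.
move=> [r1 i1 _] [r2 i2 _]; apply/funext => x.
have dr1 := smooth_is_derive x r1; have di1 := smooth_is_derive x i1.
have dr2 := smooth_is_derive x r2; have di2 := smooth_is_derive x i2.
apply: complex_eq; rewrite /cderive ?ReD ?ImD ?Re_mulc ?Im_mulc /=.
  rewrite (_ : cRe \o _ =
      (cRe c \*: (cRe \o phi) - cIm c \*: (cIm \o phi)) + (cRe \o psi)); last first.
    by apply/funext => y; rewrite /= ReD Re_mulc.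
  rewrite derive1E.
  by have [_ ->] := is_deriveD (is_deriveB (is_deriveZ (cRe c) dr1) (is_deriveZ (cIm c) di1)) dr2.
rewrite (_ : cIm \o _ =
    (cRe c \*: (cIm \o phi) + cIm c \*: (cRe \o phi)) + (cIm \o psi)); last first.
  by apply/funext => y; rewrite /= ImD Im_mulc.
rewrite derive1E.
by have [_ ->] := is_deriveD (is_deriveD (is_deriveZ (cRe c) di1) (is_deriveZ (cIm c) dr1)) di2.
Qed.

Lemma test_function_mul phi psi : test_function phi -> test_function psi ->
  test_function (fun x => phi x * psi x).
Proof.
move=> /test_functionP[r1 i1] [r2 i2 _]; apply/test_functionP; split.
  rewrite (_ : _ \o _ = fun x => cRe (phi x) * cRe (psi x) + (- 1) * (cIm (phi x) * cIm (psi x))).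
    apply: real_testD; [exact: real_test_mul r1 r2|].
    exact: real_testZ (real_test_mul i1 i2).
  by apply/funext => x /=; rewrite Re_mulc mulN1r.
rewrite (_ : _ \o _ = fun x => cRe (phi x) * cIm (psi x) + cIm (phi x) * cRe (psi x)).
  by apply: real_testD; [exact: real_test_mul r1 i2|exact: real_test_mul i1 r2].
by apply/funext => x /=; rewrite Im_mulc.
Qed.

Lemma cderive_mul phi psi : test_function phi -> test_function psi ->
  cderive (fun x => phi x * psi x) = fun x => cderive phi x * psi x + phi x * cderive psi x.
Proof.
move=> [r1 i1 _] [r2 i2 _]; apply/funext => x.
have dr1 := smooth_is_derive x r1; have di1 := smooth_is_derive x i1.
have dr2 := smooth_is_derive x r2; have di2 := smooth_is_derive x i2.
apply: complex_eq; rewrite /cderive ?ReD ?ImD !(Re_mulc, Im_mulc) /=.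
  rewrite (_ : cRe \o _ =
      (cRe \o phi) * (cRe \o psi) - (cIm \o phi) * (cIm \o psi)); last first.
    by apply/funext => y; rewrite /= Re_mulc.
  rewrite derive1E.
  have [_ ->] := is_deriveB (is_deriveM dr1 dr2) (is_deriveM di1 di2).
  by rewrite /GRing.scale/=; ring.
rewrite (_ : cIm \o _ =
    (cRe \o phi) * (cIm \o psi) + (cIm \o phi) * (cRe \o psi)); last first.
  by apply/funext => y; rewrite /= Im_mulc.
rewrite derive1E.
have [_ ->] := is_deriveD (is_deriveM dr1 di2) (is_deriveM di1 dr2).
by rewrite /GRing.scale/=; ring.
Qed.

Lemma test_function_L2 phi : test_function phi -> L2 phi.
Proof.
move=> /test_functionP[r1 i1].
have ir := real_test_integrable r1 mI; have ii := real_test_integrable i1 mI.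
split; first by split; exact: integrable_measurable.
have := integrable_add (integrable_mul_continuous ir (smooth_continuous (proj1 r1)))
  (integrable_mul_continuous ii (smooth_continuous (proj1 i1))).
by apply: (eq_integrable mI) => x _; rewrite /= normc_sqrE !expr2.
Qed.

Lemma cint_cderive phi : test_function phi -> cint (cderive phi) = 0.
Proof.
move=> /test_functionP[r1 i1]; apply: complex_eq.
  exact: Rintegral_derive_real_test r1.
exact: Rintegral_derive_real_test i1.
Qed.

Lemma is_wderiv_cderive phi : test_function phi -> is_wderiv phi (cderive phi).
Proof.
move=> tphi psi tpsi; apply/eqP; rewrite -addr_eq0; apply/eqP.
have L := test_function_L2.
rewrite -cintD; last 2 first.
- by apply: L2_mul_L1; [exact: L|apply: L; exact: test_function_cderive].
- by apply: L2_mul_L1; [apply: L; exact: test_function_cderive|exact: L].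
rewrite -(cint_cderive (test_function_mul tphi tpsi)) cderive_mul//.
by congr cint; apply/funext => x; rewrite addrC.
Qed.

(** Real and imaginary part are each bounded at every point by int |phi'|, whose square is at most
    [L2sqr (cderive phi)]; the factor 2 counts the two parts. *)
Lemma test_function_Poincare phi : test_function phi ->
  L2sqr phi <= 2 * L2sqr (cderive phi).
Proof.
move=> tphi; have Ld := test_function_L2 (test_function_cderive tphi).
have ind : mu.-integrable I (EFin \o (fun x => Normc.normc (cderive phi x))).
  by case: (L2_L1 Ld).
pose m := Rintegral mu I (fun x => Normc.normc (cderive phi x)).
have m2 : m ^+ 2 <= L2sqr (cderive phi).
  have := Cauchy_Schwarz Ld (L2_cst 1); rewrite L2sqr_cst Normc.normc1 expr1n mulr1.
  by under [X in Rintegral _ _ X]eq_fun do rewrite mulr1.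
have m0 : 0 <= m by apply: Rintegral_ge0 => x _; exact: normc_ge0.
have bnd x : I x -> Normc.normc (phi x) ^+ 2 <= 2 * L2sqr (cderive phi).
  rewrite I01E => Ix; move/test_functionP: tphi => [r1 i1].
  have hr : `|cRe (phi x)| <= m.
    apply: le_trans (real_test_sup_bound r1 Ix) _; apply: le_Rintegral => //.
      by apply: integrable_norm; exact: real_test_integrable (real_test_derive1 r1) mI.
    by move=> y _; exact: norm_Re_le (cderive phi y).
  have hi : `|cIm (phi x)| <= m.
    apply: le_trans (real_test_sup_bound i1 Ix) _; apply: le_Rintegral => //.
      by apply: integrable_norm; exact: real_test_integrable (real_test_derive1 i1) mI.
    by move=> y _; exact: norm_Im_le (cderive phi y).
  rewrite normc_sqrE -(real_normK (num_real (cRe _))) -(real_normK (num_real (cIm _))).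
  have h2 (t : R) : 0 <= t -> t <= m -> t ^+ 2 <= m ^+ 2.
    by move=> t0 tm; rewrite ler_sqr ?nnegrE.
  have := h2 _ (normr_ge0 _) hr; have := h2 _ (normr_ge0 _) hi; lra.
rewrite -[leRHS]Rintegral01_cst; apply: le_Rintegral => //.
  by case: (test_function_L2 tphi).
exact: integrable_const.
Qed.

Lemma cint_real_mul w (psi : R -> R) :
  cint (fun x => w x * (psi x)%:C) =
  Rintegral mu I (fun x => cRe (w x) * psi x) +i* Rintegral mu I (fun x => cIm (w x) * psi x).
Proof.
by apply: complex_eq; congr Rintegral; apply/funext => x /=;
  rewrite ?Re_mulc ?Im_mulc /= mulr0 ?subr0 ?add0r.
Qed.

Lemma fundamental_lemma_complex w : L1 w ->
  (forall phi, test_function phi -> cint (fun x => w x * phi x) = 0) ->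
  ae_eq01 w (fun=> 0).
Proof.
move=> /L1P[ir ii] h.
have hr : almost_all01 (fun x => cRe (w x) = 0).
  apply: fundamental_lemma ir _ => psi tpsi.
  by have := h _ (test_function_real tpsi); rewrite cint_real_mul => -[].
have hi : almost_all01 (fun x => cIm (w x) = 0).
  apply: fundamental_lemma ii _ => psi tpsi.
  by have := h _ (test_function_real tpsi); rewrite cint_real_mul => -[].
by apply: almost_all01_mono (almost_all01_and hr hi) _ => x _ [e1 e2]; exact: complex_eq.
Qed.

Lemma cderive_real (psi : R -> R) : cderive (fun x => (psi x)%:C) = fun x => (derive1 psi x)%:C.
Proof.
apply/funext => x; rewrite /cderive; apply: complex_eq => //=.
by rewrite derive1E (_ : _ \o _ = cst 0) ?derive_cst.
Qed.

Lemma du_Bois_Reymond w : L1 w ->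
  (forall phi, test_function phi -> cint (fun x => w x * cderive phi x) = 0) ->
  exists c : R[i], ae_eq01 w (fun=> c).
Proof.
move=> /L1P[ir ii] h.
have [a ha] : exists a, almost_all01 (fun x => cRe (w x) = a).
  apply: du_Bois_Reymond_real ir _ => psi tpsi.
  by have := h _ (test_function_real tpsi); rewrite cderive_real cint_real_mul => -[].
have [b hb] : exists b, almost_all01 (fun x => cIm (w x) = b).
  apply: du_Bois_Reymond_real ii _ => psi tpsi.
  by have := h _ (test_function_real tpsi); rewrite cderive_real cint_real_mul => -[].
exists (a +i* b).
by apply: almost_all01_mono (almost_all01_and ha hb) _ => x _ [e1 e2]; exact: complex_eq.
Qed.

End test_functions.

(** * The space H^1_0(0,1) *)

Section sobolev.
Context (R : realType).
Implicit Types (f g u v w q h phi psi : R -> R[i]).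

Lemma eq0_of_normc_sqr_le (z : R[i]) (a : nat -> R) :
  a @ \oo --> (0 : R) -> (forall k, Normc.normc z ^+ 2 <= a k) -> z = 0.
Proof.
move=> a0 za; apply/Normc.eq0_normc/eqP; rewrite -sqrf_eq0 eq_le sqr_ge0 andbT.
rewrite -(cvg_lim _ a0)//; apply: limr_ge; first by apply/cvg_ex; exists 0.
exact: nearW.
Qed.

Lemma cvg0_lincomb (c d : R) (a b : nat -> R) : a @ \oo --> (0 : R) -> b @ \oo --> (0 : R) ->
  (fun k => c * a k + d * b k) @ \oo --> (0 : R).
Proof.
move=> ha hb; rewrite -[X in _ --> X](_ : c * 0 + d * 0 = 0); last by ring.
by apply: cvgD; apply: cvgMr.
Qed.

Lemma cvg0_squeeze (a b : nat -> R) : (forall k, 0 <= a k <= b k) -> b @ \oo --> (0 : R) ->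
  a @ \oo --> (0 : R).
Proof.
move=> ab hb; apply: (squeeze_cvgr _ (@cvg_cst _ _ _ _ _) hb); exact: nearW.
Qed.

(** Lets the L_2 limit of test functions inherit integration by parts; the pairings converge by
    Cauchy-Schwarz. *)
Lemma cint_mul_eq_lim (a b : nat -> R -> R[i]) f g phi psi :
  (forall k, L2 (a k)) -> (forall k, L2 (b k)) -> L2 f -> L2 g -> L2 phi -> L2 psi ->
  (fun k => L2sqr (fun x => a k x - f x)) @ \oo --> (0 : R) ->
  (fun k => L2sqr (fun x => b k x - g x)) @ \oo --> (0 : R) ->
  (forall k, cint (fun x => a k x * phi x) = cint (fun x => b k x * psi x)) ->
  cint (fun x => f x * phi x) = cint (fun x => g x * psi x).
Proof.
move=> La Lb Lf Lg Lphi Lpsi af bg ab; apply/eqP; rewrite -subr_eq0; apply/eqP.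
apply: (eq0_of_normc_sqr_le (cvg0_lincomb (2 * L2sqr psi) (2 * L2sqr phi) bg af)) => k.
have Laf : L2 (fun x => a k x - f x) by exact: L2B.
have Lbg : L2 (fun x => b k x - g x) by exact: L2B.
have -> : cint (fun x => f x * phi x) - cint (fun x => g x * psi x) =
    cint (fun x => (b k x - g x) * psi x) + - cint (fun x => (a k x - f x) * phi x).
  have -> : (fun x => (b k x - g x) * psi x) = (fun x => b k x * psi x - g x * psi x).
    by apply/funext => x; rewrite mulrBl.
  have -> : (fun x => (a k x - f x) * phi x) = (fun x => a k x * phi x - f x * phi x).
    by apply/funext => x; rewrite mulrBl.
  by rewrite !cintB ?ab; try exact: L2_mul_L1; ring.
apply: le_trans (normcD_sqr_le _ _) _; rewrite normcN.
have := normc_cint_mul_le Lbg Lpsi; have := normc_cint_mul_le Laf Lphi; nra.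
Qed.

Lemma is_wderiv_unique u v w : L2 v -> L2 w -> is_wderiv u v -> is_wderiv u w -> ae_eq01 v w.
Proof.
move=> Lv Lw uv uw.
have : ae_eq01 (fun x => v x - w x) (fun=> 0).
  apply: fundamental_lemma_complex; first by apply: L2_L1; exact: L2B.
  move=> phi tphi; have Lphi := test_function_L2 tphi.
  have -> : (fun x => (v x - w x) * phi x) = (fun x => v x * phi x - w x * phi x).
    by apply/funext => x; rewrite mulrBl.
  rewrite cintB; try exact: L2_mul_L1.
  by apply/eqP; rewrite subr_eq0 -eqr_opp -uv// -uw.
by move=> h; apply: almost_all01_mono h _ => x _ /eqP; rewrite subr_eq0 => /eqP.
Qed.

Lemma is_wderiv_ae u v w : L2 v -> cmeasurable w -> ae_eq01 v w -> is_wderiv u v -> is_wderiv u w.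
Proof.
move=> [mv _] mw vw uv phi tphi; rewrite uv//; congr (- _).
have [mphi _] := test_function_L2 tphi.
apply: cint_ae; try exact: cmeasurableM.
by apply: almost_all01_mono vw _ => x _ ->.
Qed.

Lemma is_wderiv_lincomb (c : R[i]) u v u' v' : L2 u -> L2 v -> L2 u' -> L2 v' ->
  is_wderiv u u' -> is_wderiv v v' ->
  is_wderiv (fun x => c * u x + v x) (fun x => c * u' x + v' x).
Proof.
move=> Lu Lv Lu' Lv' du dv phi tphi.
have Lphi := test_function_L2 tphi.
have Ldphi := test_function_L2 (test_function_cderive tphi).
have e (f g psi : R -> R[i]) : L2 f -> L2 g -> L2 psi -> cint (fun x => (c * f x + g x) * psi x) =
    c * cint (fun x => f x * psi x) + cint (fun x => g x * psi x).
  move=> Lf Lg Lpsi; rewrite -cintZ -?cintD; try exact: L2_mul_L1.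
    by congr cint; apply/funext => x; ring.
  by apply: L1Z; exact: L2_mul_L1.
by rewrite !e// du// dv//; ring.
Qed.

Lemma wderivP u : H1 u -> [/\ L2 u, L2 (wderiv u) & is_wderiv u (wderiv u)].
Proof.
by move=> [Lu exv]; have [] := @xgetPex _ (fun=> 0 : R[i]) _ exv.
Qed.

(** [wderiv] is an arbitrary choice, so it can be computed only up to equality almost everywhere. *)
Lemma wderivE u v : L2 u -> L2 v -> is_wderiv u v -> ae_eq01 (wderiv u) v.
Proof.
move=> Lu Lv uv; have [//|_ Ld du] := @wderivP u; last exact: is_wderiv_unique du uv.
by split=> //; exists v.
Qed.

Lemma sqr_H1norm u : H1norm u ^+ 2 = L2sqr u + L2sqr (wderiv u).
Proof. by rewrite sqr_sqrtr ?addr_ge0 ?sqr_ge0// !sqr_L2norm. Qed.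

Lemma sqr_H1normB_test phi u v : test_function phi -> L2 u -> L2 v -> is_wderiv u v ->
  H1norm (fun x => phi x - u x) ^+ 2 =
  L2sqr (fun x => phi x - u x) + L2sqr (fun x => cderive phi x - v x).
Proof.
move=> tphi Lu Lv uv; have Lphi := test_function_L2 tphi.
have Ldphi := test_function_L2 (test_function_cderive tphi).
have LB : L2 (fun x => phi x - u x) by exact: L2B.
have LdB : L2 (fun x => cderive phi x - v x) by exact: L2B.
have dB : is_wderiv (fun x => phi x - u x) (fun x => cderive phi x - v x).
  have := is_wderiv_lincomb (-1) Lu Lphi Lv Ldphi uv (is_wderiv_cderive tphi).
  by congr is_wderiv; apply/funext => x; rewrite mulN1r addrC.
have [_ [mw _] _] : [/\ L2 (fun x => phi x - u x), L2 (wderiv (fun x => phi x - u x)) &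
    is_wderiv (fun x => phi x - u x) (wderiv (fun x => phi x - u x))].
  by apply: wderivP; split=> //; eexists; split; [exact: LdB|exact: dB].
rewrite sqr_H1norm; congr (_ + _); apply: L2sqr_ae => //; first by case: LdB.
exact: wderivE.
Qed.

(** The definition measures phi_k - u through a chosen weak derivative of the difference; this form
    uses the classical derivatives of the phi_k and a weak derivative of u at hand. *)
Lemma H01P u : H01 u <-> L2 u /\ exists v, [/\ L2 v, is_wderiv u v &
  exists phi : nat -> R -> R[i], [/\ forall k, test_function (phi k),
    (fun k => L2sqr (fun x => phi k x - u x)) @ \oo --> (0 : R) &
    (fun k => L2sqr (fun x => cderive (phi k) x - v x)) @ \oo --> (0 : R)]].
Proof.
split=> [[H1u [phi [tphi phiu]]]|[Lu [v [Lv uv [phi [tphi cu cv]]]]]].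
  have [Lu Lv uv] := wderivP H1u; split=> //; exists (wderiv u); split=> //.
  exists phi; have n2 : (fun k => H1norm (fun x => phi k x - u x) ^+ 2) @ \oo --> (0 : R).
    by have c2 := cvgM phiu phiu; rewrite mulr0 in c2; exact: c2.
  have e k := sqr_H1normB_test (tphi k) Lu Lv uv.
  split=> //.
    by apply: cvg0_squeeze n2 => k; rewrite e L2sqr_ge0 lerDl L2sqr_ge0.
  by apply: cvg0_squeeze n2 => k; rewrite e L2sqr_ge0 lerDr L2sqr_ge0.
split; first by split=> //; exists v.
exists phi; split=> //.
have -> : (fun k => H1norm (fun x => phi k x - u x)) =
    (fun k => Num.sqrt (1 * L2sqr (fun x => phi k x - u x) +
                        1 * L2sqr (fun x => cderive (phi k) x - v x))).
  apply/funext => k; rewrite !mul1r -sqr_H1normB_test// sqrtr_sqr ger0_norm//.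
  exact: sqrtr_ge0.
rewrite -[X in _ --> X](@sqrtr0 R).
by apply: continuous_cvg; [exact: sqrt_continuous|exact: cvg0_lincomb].
Qed.

Lemma H01_H1 u : H01 u -> H1 u.
Proof. by case. Qed.

Lemma H01_approx u : H01 u -> exists phi : nat -> R -> R[i], [/\ forall k, test_function (phi k),
    (fun k => L2sqr (fun x => phi k x - u x)) @ \oo --> (0 : R) &
    (fun k => L2sqr (fun x => cderive (phi k) x - wderiv u x)) @ \oo --> (0 : R)].
Proof.
move=> Hu; have /H01P[Lu [v [Lv uv [phi [tphi cu cv]]]]] := Hu.
have [_ Lw _] := wderivP (H01_H1 Hu).
exists phi; split=> //.
rewrite (_ : (fun k => _) = (fun k => L2sqr (fun x => cderive (phi k) x - v x)))//.
apply/funext => k; have Lk := test_function_L2 (test_function_cderive (tphi k)).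
apply: L2sqr_ae; [by case: (L2B Lk Lw)|by case: (L2B Lk Lv)|].
by apply: almost_all01_mono (wderivE Lu Lv uv) _ => x _ ->.
Qed.

Lemma test_function_H01 phi : test_function phi -> H01 phi.
Proof.
move=> tphi; have Lphi := test_function_L2 tphi.
have Ldphi := test_function_L2 (test_function_cderive tphi).
have zero f : (fun k : nat => L2sqr (fun x => f x - f x : R[i])) @ \oo --> (0 : R).
  rewrite (_ : (fun _ => _) = cst 0); first exact: cvg_cst.
  apply/funext => k; rewrite -[RHS](_ : L2sqr (fun=> 0 : R[i]) = 0).
    by congr L2sqr; apply/funext => x; rewrite subrr.
  by rewrite L2sqr_cst Normc.normc0 expr0n.
apply/H01P; split=> //; exists (cderive phi); split=> //; first exact: is_wderiv_cderive.
by exists (fun=> phi); split.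
Qed.

Lemma H01_lincomb (c : R[i]) u v : H01 u -> H01 v -> H01 (fun x => c * u x + v x).
Proof.
move=> /H01P[Lu [u' [Lu' uu' [phi [tphi cu cu']]]]] /H01P[Lv [v' [Lv' vv' [psi [tpsi cv cv']]]]].
apply/H01P; split; first by apply: L2D => //; exact: L2Z.
exists (fun x => c * u' x + v' x); split.
- by apply: L2D => //; exact: L2Z.
- exact: is_wderiv_lincomb.
have lin (a b : nat -> R -> R[i]) f g : (forall k, L2 (a k)) -> (forall k, L2 (b k)) ->
    L2 f -> L2 g ->
    (fun k => L2sqr (fun x => a k x - f x)) @ \oo --> (0 : R) ->
    (fun k => L2sqr (fun x => b k x - g x)) @ \oo --> (0 : R) ->
    (fun k => L2sqr (fun x => c * a k x + b k x - (c * f x + g x))) @ \oo --> (0 : R).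
  move=> La Lb Lf Lg af bg.
  apply: cvg0_squeeze (cvg0_lincomb (2 * Normc.normc c ^+ 2) 2 af bg) => k.
  rewrite L2sqr_ge0/=.
  have Laf : L2 (fun x => a k x - f x) by exact: L2B.
  have Lbg : L2 (fun x => b k x - g x) by exact: L2B.
  have := L2sqrD_le (L2Z c Laf) Lbg; rewrite L2sqrZ// mulrA.
  congr (_ <= _); congr L2sqr; apply/funext => x; ring.
exists (fun k x => c * phi k x + psi k x); split.
- by move=> k; exact: test_function_lincomb.
- by apply: lin => // k; exact: test_function_L2.
- rewrite (_ : (fun k => _) = (fun k => L2sqr (fun x =>
      c * cderive (phi k) x + cderive (psi k) x - (c * u' x + v' x)))).
    by apply: lin => // k; apply: test_function_L2; exact: test_function_cderive.
  by apply/funext => k; rewrite cderive_lincomb.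
Qed.

Lemma wderiv_lincomb (c : R[i]) u v : H01 u -> H01 v ->
  ae_eq01 (wderiv (fun x => c * u x + v x)) (fun x => c * wderiv u x + wderiv v x).
Proof.
move=> /H01_H1/wderivP[Lu Lu' uu'] /H01_H1/wderivP[Lv Lv' vv'].
apply: wderivE; last exact: is_wderiv_lincomb.
  by apply: L2D => //; exact: L2Z.
by apply: L2D => //; exact: L2Z.
Qed.

(** The inequality for test functions passes to the limit; 8 is its constant 2 times a factor 2 for
    each of the two splittings, of u and of phi_k'. *)
Lemma H01_Poincare u : H01 u -> L2sqr u <= 8 * L2sqr (wderiv u).
Proof.
move=> Hu; have [phi [tphi cu cv]] := H01_approx Hu.
have [Lu Lw _] := wderivP (H01_H1 Hu).
rewrite -subr_le0 -(cvg_lim _ (cvg0_lincomb 2 8 cu cv))//.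
apply: limr_ge; first by apply/cvg_ex; exists 0; exact: cvg0_lincomb.
apply: nearW => k; have Lk := test_function_L2 (tphi k).
have Ldk := test_function_L2 (test_function_cderive (tphi k)).
have h1 : L2sqr u <= 2 * L2sqr (fun x => phi k x - u x) + 2 * L2sqr (phi k).
  rewrite (_ : L2sqr u = L2sqr (fun x => (u x - phi k x) + phi k x)); last first.
    by congr L2sqr; apply/funext => x; rewrite subrK.
  by rewrite (L2sqrBC (phi k)); apply: L2sqrD_le => //; exact: L2B.
have h2 := test_function_Poincare (tphi k).
have h3 : L2sqr (cderive (phi k)) <=
    2 * L2sqr (fun x => cderive (phi k) x - wderiv u x) + 2 * L2sqr (wderiv u).
  rewrite (_ : L2sqr (cderive (phi k)) =
      L2sqr (fun x => (cderive (phi k) x - wderiv u x) + wderiv u x)); last first.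
    by congr L2sqr; apply/funext => x; rewrite subrK.
  by apply: L2sqrD_le => //; exact: L2B.
lra.
Qed.

Lemma Hm1_Riesz l : Hm1 l -> exists2 h, L2 h & forall u, H01 u ->
  l u = cint (fun x => wderiv u x * h x).
Proof.
move=> [llin [C lC]].
(* 9 = 8 + 1: by Poincare |u|^2 + |u'|^2 <= 9 |u'|^2, so the norm of the derivative alone controls
   l. *)
have [||||||h [Lh lh _]] := @Riesz_representation R (@H01 R) (@wderiv R) l (C ^+ 2 * 9).
- by exists (fun=> 0); apply: test_function_H01; exact: test_function0.
- by move=> c u v; exact: H01_lincomb.
- by move=> u /H01_H1/wderivP[].
- by move=> c u v; exact: wderiv_lincomb.
- exact: llin.
- move=> u Hu; have H0 : 0 <= H1norm u by exact: sqrtr_ge0.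
  have h1 : Normc.normc (l u) ^+ 2 <= (C * H1norm u) ^+ 2.
    by have := lC u Hu; have := normc_ge0 (l u); nra.
  apply: le_trans h1 _; rewrite exprMn sqr_H1norm -mulrA ler_wpM2l ?sqr_ge0//.
  by have := H01_Poincare Hu; lra.
(* [L2dot] conjugates its second argument. *)
exists (fun x => (h x)^*); first exact: L2_conj.
exact: lh.
Qed.

(** Derivatives of test functions have integral 0, and the mean is continuous in L_2. *)
Lemma cint_wderiv u : H01 u -> cint (wderiv u) = 0.
Proof.
move=> Hu; have [phi [tphi _ cv]] := H01_approx Hu.
have [_ Lw _] := wderivP (H01_H1 Hu).
apply: (eq0_of_normc_sqr_le cv) => k.
have Ldk := test_function_L2 (test_function_cderive (tphi k)).
rewrite -normcN.
have -> : - cint (wderiv u) = cint (fun x => cderive (phi k) x - wderiv u x).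
  by rewrite cintB ?cint_cderive ?sub0r//; exact: L2_L1.
by apply: normc_cint_L2_le; exact: L2B.
Qed.

(* If q has mean zero, its projection h on the closure of the derivatives of test
   functions differs from q by a constant (du Bois-Reymond), which is zero since h
   has mean zero too; by Poincare the test functions themselves converge. *)
Lemma g0P q : g0 q <-> L2 q /\ cint q = 0.
Proof.
split=> [[Lq [u [Hu uq]]]|[Lq q0]].
  split=> //; rewrite -(cint_wderiv Hu).
  have [Lu Lw uw] := wderivP (H01_H1 Hu).
  by apply: cint_ae; [case: Lq|case: Lw|exact: is_wderiv_unique uq uw].
have LD phi : test_function phi -> L2 (cderive phi).
  by move=> tphi; apply: test_function_L2; exact: test_function_cderive.
pose l phi := L2dot (cderive phi) q.
have [||||||h [Lh lh [phi [tphi cphi]]]] :=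
  @Riesz_representation R (@test_function R) (@cderive R) l (L2sqr q).
- by exists (fun=> 0); exact: test_function0.
- by move=> c u v; exact: test_function_lincomb.
- exact: LD.
- by move=> c u v tu tv; rewrite cderive_lincomb//; exact: almost_all01T.
- move=> c u v tu tv; rewrite /l /L2dot cderive_lincomb// -cintZ -?cintD; last 3 first.
  + by apply: L1Z; apply: L2dot_L1 => //; exact: LD.
  + by apply: L2dot_L1 => //; exact: LD.
  + by apply: L2dot_L1 => //; exact: LD.
  by congr cint; apply/funext => x; ring.
- by move=> u tu; rewrite mulrC; apply: L2dot_le => //; exact: LD.
have h0 : cint h = 0.
  apply: (eq0_of_normc_sqr_le cphi) => k; rewrite -normcN.
  have -> : - cint h = cint (fun x => cderive (phi k) x - h x).
    by rewrite cintB ?cint_cderive ?sub0r//; apply: L2_L1 => //; exact: LD.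
  by apply: normc_cint_L2_le; apply: L2B => //; exact: LD.
have qh : ae_eq01 h q.
  have LB : L2 (fun x => q x - h x) by exact: L2B.
  (* The conjugate turns orthogonality for the sesquilinear [L2dot] into the bilinear condition of
     [du_Bois_Reymond]. *)
  have [c hc] : exists c : R[i], ae_eq01 (fun x => (q x - h x)^*) (fun=> c).
    apply: du_Bois_Reymond; first by apply: L2_L1; exact: L2_conj.
    move=> psi tpsi.
    rewrite (_ : cint _ = L2dot (cderive psi) (fun x => q x - h x)); last first.
      by congr cint; apply/funext => x; rewrite mulrC.
    by rewrite L2dotBr//; [rewrite -lh// subrr|exact: LD].
  have hc' : ae_eq01 (fun x => q x - h x) (fun=> c^*).
    by apply: almost_all01_mono hc _ => x _ <-; rewrite conjCK.
  have : cint (fun x => q x - h x) = c^*.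
    rewrite -[RHS]cint_cst; apply: cint_ae hc'; first by case: LB.
    exact: cmeasurable_cst.
  rewrite cintB ?q0 ?h0 ?subrr; try exact: L2_L1.
  move=> c0; apply: almost_all01_mono hc' _ => x _; rewrite -c0.
  by move/eqP; rewrite subr_eq0 => /eqP ->.
have [u Lu cu] : exists2 u, L2 u & (fun k => L2sqr (fun x => phi k x - u x)) @ \oo --> (0 : R).
  apply: L2_complete => [k|e e0]; first exact: test_function_L2.
  (* One factor 2 comes from Poincare, one from splitting phi_j' - phi_k' at h, and one from the two
     resulting terms. *)
  have e8 : 0 < e / 8 by rewrite divr_gt0.
  have alg (x y z : R) : y <= e / 8 -> z <= e / 8 -> x <= 2 * y + 2 * z -> 2 * x <= e by lra.
  have /cvgrPdist_le /(_ _ e8) [K _ KP] := cphi.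
  have small i : (K <= i)%N -> L2sqr (fun x => cderive (phi i) x - h x) <= e / 8.
    by move=> Ki; apply: le_trans (KP i Ki); rewrite /= sub0r normrN; exact: ler_norm.
  exists K => j k /small hj /small hk.
  have tjk := test_function_lincomb (-1) (tphi k) (tphi j).
  have p := test_function_Poincare tjk.
  rewrite (_ : (fun x => phi j x - phi k x) = (fun x => -1 * phi k x + phi j x)); last first.
    by apply/funext => x; rewrite mulN1r addrC.
  have d : L2sqr (cderive (fun x => -1 * phi k x + phi j x)) <=
      2 * L2sqr (fun x => cderive (phi j) x - h x) + 2 * L2sqr (fun x => cderive (phi k) x - h x).
    rewrite cderive_lincomb// (L2sqrBC (cderive (phi k))).
    rewrite (_ : (fun x => _) =
        (fun x => (cderive (phi j) x - h x) + (h x - cderive (phi k) x))); last first.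
      by apply/funext => x; ring.
    by apply: L2sqrD_le; apply: L2B => //; exact: LD.
  by apply: le_trans p _; exact: alg hj hk d.
have uh : is_wderiv u h.
  move=> psi tpsi; have Lpsi := test_function_L2 tpsi; have Ldpsi := LD _ tpsi.
  (* The minus sign is moved to psi so that both sides become pairings as in [cint_mul_eq_lim]. *)
  rewrite -cintN; last exact: L2_mul_L1.
  rewrite [RHS](_ : _ = cint (fun x => h x * - psi x)); last first.
    by congr cint; apply/funext => x; rewrite mulrN.
  apply: (@cint_mul_eq_lim phi (fun k => cderive (phi k))) => //.
  - by move=> k; exact: test_function_L2.
  - by move=> k; exact: LD.
  - exact: L2N.
  move=> k; rewrite (is_wderiv_cderive (tphi k))// -cintN; last first.
    by apply: L2_mul_L1 => //; exact: LD.
  by congr cint; apply/funext => x; rewrite mulrN.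
split=> //; exists u; split.
  by apply/H01P; split=> //; exists h; split=> //; exists phi.
by apply: is_wderiv_ae uh => //; case: Lq.
Qed.

End sobolev.

(** * G-convergence *)

Lemma cvg_opp_div (K : numFieldType) (x y : nat -> K) (a b : K) :
  b != 0 -> (fun n => x n : K^o) @ \oo --> (a : K^o) -> (fun n => y n : K^o) @ \oo --> (b : K^o) ->
  (fun n => - x n / y n : K^o) @ \oo --> (- a / b : K^o).
Proof. by move=> b0 xa yb; apply: cvgM; [exact: cvgN|exact: cvgV]. Qed.

Lemma cvg_add_mul (K : numFieldType) (x y z : nat -> K) (a b c : K) :
  (fun n => x n : K^o) @ \oo --> (a : K^o) -> (fun n => y n : K^o) @ \oo --> (b : K^o) ->
  (fun n => z n : K^o) @ \oo --> (c : K^o) ->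
  (fun n => x n + y n * z n : K^o) @ \oo --> (a + b * c : K^o).
Proof. by move=> xa yb zc; apply: cvgD => //; exact: cvgM. Qed.

Section G_convergence.
Context (R : realType).
Implicit Types (a b f g h q r p u w : R -> R[i]).

Lemma Linf_L2 b : Linf b -> L2 b.
Proof.
move=> Lb; rewrite (_ : b = fun x => b x * 1); last by apply/funext => x; rewrite mulr1.
exact: Linf_mul_L2 Lb (L2_cst 1).
Qed.

Lemma cint_conj f : L1 f -> cint (fun x => (f x)^*) = (cint f)^*.
Proof.
move=> /L1P[ir ii]; apply: complex_eq => /=.
  by congr Rintegral; apply/funext => x /=; case: (f x).
rewrite -mulN1r -RintegralZl//; last exact: measurable_I01.
by congr Rintegral; apply/funext => x /=; rewrite mulN1r; case: (f x).
Qed.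

(** With c the mean of w, the function p = (w - c)^* has mean zero and yields |w - c|^2 = 0 in L_2.
    This is the step that integrates the differential equation. *)
Lemma ae_eq01_cst_of_orthogonal w : L2 w ->
  (forall p, L2 p -> cint p = 0 -> cint (fun x => w x * p x) = 0) ->
  exists c : R[i], ae_eq01 w (fun=> c).
Proof.
move=> Lw h; pose c := cint w; exists c.
have Lz : L2 (fun x => w x - c) by apply: L2B => //; exact: L2_cst.
have Lp : L2 (fun x => (w x - c)^*) by exact: L2_conj.
have p0 : cint (fun x => (w x - c)^*) = 0.
  rewrite cint_conj ?cintB ?cint_cst ?subrr ?conjC0//; try exact: L2_L1.
  exact: L2_L1 (L2_cst c).
have : L2sqr (fun x => w x - c) = 0.
  have := L2dot_self (fun x => w x - c).
  rewrite /L2dot (_ : (fun x => (w x - c) * _) =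
      (fun x => w x * (w x - c)^* - c * (w x - c)^*)); last first.
    by apply/funext => x; rewrite mulrBl.
  rewrite cintB; [|exact: L2_mul_L1|by apply: L1Z; exact: L2_L1].
  by rewrite h// cintZ ?p0 ?mulr0 ?subrr; [case|exact: L2_L1].
move=> /(L2sqr_eq0 Lz) z0; apply: almost_all01_mono z0 _ => x _ /eqP.
by rewrite subr_eq0 => /eqP.
Qed.

(** When b has nonzero mean, this is the k for which b (g + k) has mean zero: with b the inverse of
    a coefficient, g + k is the flux of a function whose derivative is b (g + k), an element of
    g_0. *)
Definition flux_cst b g : R[i] := - cint (fun x => b x * g x) / cint b.

Lemma cint_mulD b g (k : R[i]) : Linf b -> L1 g ->
  cint (fun x => b x * (g x + k)) = cint (fun x => b x * g x) + k * cint b.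
Proof.
move=> Lb Lg; have Lb1 := L2_L1 (Linf_L2 Lb).
rewrite -cintZ// -cintD; [|exact: Linf_mul_L1|exact: L1Z].
by congr cint; apply/funext => x; ring.
Qed.

Lemma cint_flux b g : Linf b -> L1 g -> cint b != 0 ->
  cint (fun x => b x * (g x + flux_cst b g)) = 0.
Proof. by move=> Lb Lg b0; rewrite cint_mulD// divfK// subrr. Qed.

Lemma flux_cst_unique b g (k : R[i]) : Linf b -> L1 g -> cint b != 0 ->
  cint (fun x => b x * (g x + k)) = 0 -> k = flux_cst b g.
Proof.
move=> Lb Lg b0; rewrite cint_mulD// => /eqP; rewrite addrC addr_eq0 => /eqP h.
by rewrite /flux_cst -h mulfK.
Qed.

Lemma Linf_unit_flux a q g (k : R[i]) : Linf_unit a ->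
  ae_eq01 (fun x => a x * q x) (fun x => g x + k) ->
  ae_eq01 q (fun x => Linv a x * (g x + k)).
Proof.
move=> [_ a0 _] h; apply: almost_all01_mono (almost_all01_and a0 h) _ => x _ [ax0 <-].
by rewrite /Linv mulKf.
Qed.

(** Makes the inverse operator bounded: the factor b is controlled by its essential bound M, and the
    constant by Cauchy-Schwarz applied to int b g. *)
Lemma L2sqr_flux_le b : Linf b -> exists2 K : R, 0 <= K &
  forall g, L2 g -> L2sqr (fun x => b x * (g x + flux_cst b g)) <= K * L2sqr g.
Proof.
move=> Lb; have [_ [M bM]] := Lb; have L2b := Linf_L2 Lb.
pose B := Normc.normc (cint b)^-1 ^+ 2.
exists (M ^+ 2 * (2 + 2 * (L2sqr b * B))).
  have := mulr_ge0 (L2sqr_ge0 b) (sqr_ge0 (Normc.normc (cint b)^-1)).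
  by have := sqr_ge0 M; rewrite -/B; nra.
move=> g Lg; have Lc := @L2_cst R (flux_cst b g).
apply: le_trans (L2sqr_Linf_mul Lb (L2D Lg Lc) bM) _.
rewrite -mulrA ler_wpM2l ?sqr_ge0//.
apply: le_trans (L2sqrD_le Lg Lc) _.
rewrite L2sqr_cst /flux_cst Normc.normcM normcN exprMn -/B.
have := normc_cint_mul_le L2b Lg; have : 0 <= B by exact: sqr_ge0.
move: (Normc.normc _ ^+ 2) B (L2sqr b) (L2sqr g) => z B x y B0 zxy.
have : z * B <= x * y * B by rewrite ler_wpM2r.
lra.
Qed.

Lemma MOmega_of_mean_inv a : Linf_unit a -> mean (Linv a) != 0 -> MOmega a.
Proof.
move=> ua m0; have [La a0 Lb] := ua; split=> //.
(* The inverse of the compression: a (S r) - r is almost everywhere a constant, hence orthogonal to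
   g_0, and the value of that constant puts S r into g_0. *)
pose S r x := Linv a x * (r x + flux_cst (Linv a) r).
have LS r : L2 r -> L2 (S r).
  by move=> Lr; apply: Linf_mul_L2 => //; apply: L2D => //; exact: L2_cst.
exists S; split.
- move=> r gr; have /g0P[Lr r0] := gr; have Lr1 := L2_L1 Lr.
  split; first by apply/g0P; split; [exact: LS|exact: cint_flux].
  split=> // p /g0P[Lp p0]; have Lc := @L2_cst R (flux_cst (Linv a) r).
  have -> : L2dot (mulop a (S r)) p = L2dot (fun x => r x + flux_cst (Linv a) r) p.
    apply: cint_ae.
    + by apply: L1_cmeasurable; apply: L2dot_L1 => //; apply: Linf_mul_L2 => //; exact: LS.
    + by apply: L1_cmeasurable; apply: L2dot_L1 => //; exact: L2D.
    + apply: almost_all01_mono a0 _ => x _ ax0; congr (_ * _).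
      by rewrite /mulop /S /Linv mulVKf.
  have Lpc := L2_L1 (L2_conj Lp).
  rewrite /L2dot (_ : (fun x => (_ + _) * _) =
      (fun x => r x * (p x)^* + flux_cst (Linv a) r * (p x)^*)); last first.
    by apply/funext => x; rewrite mulrDl.
  rewrite cintD; [|exact: L2dot_L1|exact: L1Z].
  by rewrite cintZ// cint_conj ?p0 ?conjC0 ?mulr0 ?addr0//; exact: L2_L1.
- move=> q r [/g0P[Lq q0] [/g0P[Lr r0] h]]; have Lr1 := L2_L1 Lr.
  have Laq : L2 (mulop a q) by exact: Linf_mul_L2.
  have [k hk] : exists k : R[i], ae_eq01 (fun x => mulop a q x - r x) (fun=> k).
    apply: ae_eq01_cst_of_orthogonal; first exact: L2B.
    move=> p Lp p0.
    (* [compression] tests with [L2dot], so p enters through its conjugate, which again has mean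
       zero. *)
    have gp : g0 (fun x => (p x)^*).
      by apply/g0P; split; [exact: L2_conj|rewrite cint_conj ?p0 ?conjC0//; exact: L2_L1].
    have := h _ gp; rewrite /L2dot.
    have conj2 f : (fun x => f x * (p x)^*^*) = (fun x => f x * p x).
      by apply/funext => x; rewrite conjCK.
    rewrite !conj2 => e.
    rewrite (_ : (fun x => _) = (fun x => mulop a q x * p x - r x * p x)); last first.
      by apply/funext => x; rewrite mulrBl.
    by rewrite cintB ?e ?subrr//; exact: L2_mul_L1.
  have qE : ae_eq01 q (fun x => Linv a x * (r x + k)).
    apply: (Linf_unit_flux ua); apply: almost_all01_mono hk _ => x _ /eqP.
    by rewrite subr_eq addrC => /eqP.
  have kE : k = flux_cst (Linv a) r.
    apply: flux_cst_unique => //; rewrite -q0; apply: cint_ae; last exact: ae_eq01_sym.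
      by apply: L2_cmeasurable; apply: Linf_mul_L2 => //; apply: L2D => //; exact: L2_cst.
    by case: Lq.
  by apply: ae_eq01_sym; rewrite kE in qE.
- have [K K0 KP] := L2sqr_flux_le Lb; exists (Num.sqrt K) => r /g0P[Lr _].
  rewrite -ler_sqr ?nnegrE ?mulr_ge0 ?sqrtr_ge0 ?L2norm_ge0//.
  by rewrite exprMn !sqr_L2norm (sqr_sqrtr K0); exact: KP.
Qed.

(** Both fluxes have the distributional derivative -l, so their difference annihilates the
    derivatives of H^1_0 functions, which are all the mean-zero functions in L_2. *)
Lemma solves_diff_cst a b l u w : Linf a -> Linf b -> solves a l u -> solves b l w ->
  exists k : R[i], ae_eq01 (fun x => a x * wderiv u x) (fun x => b x * wderiv w x + k).
Proof.
move=> La Lb [Hu su] [Hw sw].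
have [_ Lu _] := wderivP (H01_H1 Hu); have [_ Lw _] := wderivP (H01_H1 Hw).
have Lau : L2 (mulop a (wderiv u)) by exact: Linf_mul_L2.
have Lbw : L2 (mulop b (wderiv w)) by exact: Linf_mul_L2.
have [k hk] : exists k : R[i],
    ae_eq01 (fun x => mulop a (wderiv u) x - mulop b (wderiv w) x) (fun=> k).
  apply: ae_eq01_cst_of_orthogonal; first exact: L2B.
  move=> p Lp p0; have /g0P[_ [phi [Hphi dphi]]] := conj Lp p0.
  have [Lphi Ldphi _] := wderivP (H01_H1 Hphi).
  (* p agrees only almost everywhere with the chosen [wderiv phi] against which the equations are
     tested. *)
  have e f : L2 f -> cint (fun x => f x * p x) = cint (fun x => f x * wderiv phi x).
    move=> Lf; apply: cint_ae; try by apply: L1_cmeasurable; exact: L2_mul_L1.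
    by apply: almost_all01_mono (wderivE Lphi Lp dphi) _ => x _ ->.
  rewrite (_ : (fun x => _) =
      (fun x => mulop a (wderiv u) x * p x - mulop b (wderiv w) x * p x)); last first.
    by apply/funext => x; rewrite mulrBl.
  rewrite cintB; try exact: L2_mul_L1.
  by rewrite !e//; have := su _ Hphi; rewrite -(sw _ Hphi) /neg_deriv => ->; rewrite subrr.
exists k; apply: almost_all01_mono hk _ => x _ /eqP.
by rewrite subr_eq addrC => /eqP.
Qed.

(** The case in which every inverse coefficient has nonzero mean; the theorem reduces to it by
    dropping finitely many terms. *)
Lemma weakstar_G_converges (an : nat -> R -> R[i]) b : (forall n, Linf_unit (an n)) ->
  Linf_unit b -> (forall n, mean (Linv (an n)) != 0) -> mean b != 0 ->
  weakstar_cvg (fun n => Linv (an n)) b -> G_converges an (Linv b).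
Proof.
move=> uan ub mn mb cvgb; have [Lb b0 LVb] := ub.
have LinvK f : Linv (Linv f) = f by apply/funext => x; rewrite /Linv invrK.
have uVb : Linf_unit (Linv b).
  split=> //; last by rewrite LinvK.
  by apply: almost_all01_mono b0 _ => x _; rewrite /Linv invr_eq0.
split.
- by move=> n; exact: MOmega_of_mean_inv.
- by apply: MOmega_of_mean_inv => //; rewrite LinvK.
move=> l _ un u sun su l' Hl'; have [h Lh l'E] := Hm1_Riesz Hl'.
have Hu : H01 u by case: su.
have Hun n : H01 (un n) by case: (sun n).
have [_ Lu _] := wderivP (H01_H1 Hu).
pose g x := Linv b x * wderiv u x.
have Lg : L2 g by exact: Linf_mul_L2.
have Lg1 := L2_L1 Lg.
have Lan n : Linf (an n) by case: (uan n).
have LVan n : Linf (Linv (an n)) by case: (uan n).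
pose k n := flux_cst (Linv (an n)) g.
have unE n : ae_eq01 (wderiv (un n)) (fun x => Linv (an n) x * (g x + k n)).
  have [c hc] := solves_diff_cst (Lan n) LVb (sun n) su.
  have q := Linf_unit_flux (uan n) hc.
  suff -> : k n = c by [].
  apply/esym; apply: flux_cst_unique => //; rewrite -(cint_wderiv (Hun n)).
  have [_ Lun _] := wderivP (H01_H1 (Hun n)).
  apply: cint_ae; last exact: ae_eq01_sym.
    by apply: L2_cmeasurable; apply: Linf_mul_L2 => //; apply: L2D => //; exact: L2_cst.
  by case: Lun.
have bgE : ae_eq01 (fun x => b x * g x) (wderiv u).
  by apply: almost_all01_mono b0 _ => x _ bx0; rewrite /g /Linv mulVKf.
have Lbg : L2 (fun x => b x * g x) by exact: Linf_mul_L2.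
have cbg : cint (fun x => b x * g x) = 0.
  by rewrite -(cint_wderiv Hu); apply: cint_ae bgE; [case: Lbg|case: Lu].
have cg : (fun n => cint (fun x => Linv (an n) x * g x) : R[i]^o) @ \oo --> (0 : R[i]^o).
  by rewrite -cbg; exact: cvgb.
have c1 : (fun n => cint (Linv (an n)) : R[i]^o) @ \oo --> (cint b : R[i]^o).
  have := cvgb _ (L2_L1 (L2_cst 1)).
  have one f : (fun x => f x * 1) = f by apply/funext => x; rewrite mulr1.
  by rewrite one; under eq_fun do rewrite one.
have ck : (fun n => k n : R[i]^o) @ \oo --> (0 : R[i]^o).
  by have := cvg_opp_div mb cg c1; rewrite oppr0 mul0r; exact.
have l'un n : l' (un n) = cint (fun x => Linv (an n) x * (g x * h x)) +
    k n * cint (fun x => Linv (an n) x * h x).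
  have [_ Lun _] := wderivP (H01_H1 (Hun n)).
  have Lgh : L1 (fun x => g x * h x) by exact: L2_mul_L1.
  have Lgk : L2 (fun x => g x + k n) by apply: L2D => //; exact: L2_cst.
  have Lah : L1 (fun x => Linv (an n) x * h x) by apply: L2_L1; exact: Linf_mul_L2.
  have Lagh : L1 (fun x => Linv (an n) x * (g x * h x)) by exact: Linf_mul_L1.
  have Lagk : L2 (fun x => Linv (an n) x * (g x + k n)) by exact: Linf_mul_L2.
  rewrite -(cintZ (k n) Lah) -(cintD Lagh (L1Z (k n) Lah)) (l'E _ (Hun n)).
  transitivity (cint (fun x => Linv (an n) x * (g x + k n) * h x)).
    apply: cint_ae; last by apply: almost_all01_mono (unE n) _ => x _ ->.
      by apply: L1_cmeasurable; exact: L2_mul_L1.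
    by apply: L1_cmeasurable; exact: L2_mul_L1.
  by congr cint; apply/funext => x; ring.
(* The zero term is kept so that the limit has the shape a + b c of [cvg_add_mul], with 0 the limit
   of [k n]. *)
have l'u : l' u = cint (fun x => b x * (g x * h x)) + 0 * cint (fun x => b x * h x).
  rewrite l'E// mul0r addr0; apply: cint_ae.
  - by apply: L1_cmeasurable; exact: L2_mul_L1.
  - by apply: L1_cmeasurable; apply: Linf_mul_L1 => //; exact: L2_mul_L1.
  - by apply: almost_all01_mono bgE _ => x _ <-; rewrite mulrA.
rewrite l'u (_ : (fun n => l' (un n)) = (fun n =>
    cint (fun x => Linv (an n) x * (g x * h x)) +
    k n * cint (fun x => Linv (an n) x * h x))); last by apply/funext.
apply: (@cvg_add_mul R[i]); [by apply: cvgb; exact: L2_mul_L1|exact: ck|].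
by apply: cvgb; exact: L2_L1.
Qed.

End G_convergence.

(* M(Omega) contains alpha n only for n large enough (when the mean of the
   inverse of alpha n is nonzero), so G-convergence is that of a tail. *)
Theorem theorem2p5 (R : realType) (alpha : nat -> R -> R[i]) (beta : R -> R[i])
    (halpha : forall n : nat, Linf_unit (alpha n))
    (hbeta : Linf beta)
    (hcvg : weakstar_cvg (fun n : nat => Linv (alpha n)) beta)
    (hmean : mean beta != 0)
    (hinv : Linf_unit beta) :
  exists N : nat, G_converges (fun n : nat => alpha (N + n)%N) (Linv beta).
Proof.
(* Testing with the constant 1, an L_1 function, turns weak-* convergence into convergence of the
   means. *)
have c1 : (fun n => cint (Linv (alpha n)) : R[i]^o) @ \oo --> (cint beta : R[i]^o).
  have := hcvg _ (L2_L1 (@L2_cst R 1)).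
  have one (f : R -> R[i]) : (fun x => f x * 1) = f by apply/funext => x; rewrite mulr1.
  by rewrite one; under eq_fun do rewrite one.
have [N _ NP] := cvgr_neq0 _ c1 hmean.
exists N; apply: (weakstar_G_converges (fun n => halpha (N + n)%N) hinv _ hmean).
  by move=> n; exact: NP (leq_addr n N).
move=> g Lg.
have -> : (fun n => cint (fun x => Linv (alpha (N + n)%N) x * g x)) =
    (fun n => cint (fun x => Linv (alpha (n + N)%N) x * g x)).
  by apply/funext => n; rewrite addnC.
rewrite (cvg_shiftn N (fun n => cint (fun x => Linv (alpha n) x * g x) : R[i]^o)).
exact: hcvg.
Qed.
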